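(* Let $\mathbb{G}=\langle g\rangle$ be a group of prime order $q$ and let $H:\mathbb{Z}_q\times\mathbb{Z}_q\to\mathbb{Z}_q$ be modeled as a random oracle. The two-party key-generation protocol between a browser and a token defined in the context is bias-free and zero knowledge, i.e., for efficient (possibly malicious) parties: 1. (Bias-free, honest browser) If the browser is honest, then at the conclusion of the protocol it holds a public key $X$ drawn from a distribution statistically close to uniform over $\mathbb{G}$. 2. (Bias-free, honest token) If the token is honest, then at the conclusion of the protocol it holds a private key $x$ drawn from a distribution statistically close to uniform over $\mathbb{Z}_q$, provided that the browser never causes the token to output $\bot$. 3. (Zero knowledge) If the token is honest, then for every efficient malicious browser that never causes the token to output $\bot$ there exists an efficient simulator that, given only the output public key $X=V'\cdot g^{v}$ as input, produces an output computationally indistinguishable from the malicious browser's view of the protocol.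
   Context: The security parameter is (polynomially related to) $\log q$; ''efficient'' means probabilistic polynomial time in the security parameter, and in particular making at most polynomially many queries to the random oracle $H$. ''Statistically close'' means statistical distance negligible in the security parameter. Groups are written multiplicatively. **Key-generation protocol.** 1. The browser samples $v\leftarrow\mathbb{Z}_q$ and $r\leftarrow\mathbb{Z}_q$ uniformly and sends $c\leftarrow H(v,r)$ to the token. 2. The token samples $v'\leftarrow\mathbb{Z}_q$ uniformly and sends $V'\leftarrow g^{v'}\in\mathbb{G}$ to the browser. 3. The browser sends $(v,r)$ to the token, and outputs $X\leftarrow V'\cdot g^v\in\mathbb{G}$ as the public key. 4. The token checks that $H(v,r)=c$. If so, it outputs the private key $x\leftarrow v+v'\in\mathbb{Z}_q$; otherwise it outputs the failure symbol $\bot$. For a malicious browser, which may deviate arbitrarily in the messages $c$ and $(v,r)$ it sends, the output public key is $X=V'\cdot g^v$ for the value $v$ it sends in step 3, and its view is the transcript $(c,V',(v,r))$. A malicious token may choose $V'\in\mathbb{G}$ arbitrarily as a function of $c$ and its oracle queries. *)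

(* Defs.v *)
From HB Require Import structures.
From mathcomp Require Import all_boot all_order all_algebra all_fingroup.

Set Implicit Arguments.
Unset Strict Implicit.
Unset Printing Implicit Defensive.
Import Order.TTheory GRing.Theory Num.Theory.
Local Open Scope ring_scope.

(* [n ^ c + c], with [c] arbitrary, dominates every polynomial in [n]. *)
Definition poly_le (f g : nat -> nat) : Prop :=
  exists c : nat, forall n, (f n <= g n ^ c + c)%N.

Definition poly_bounded (f : nat -> nat) : Prop := poly_le f id.

Definition poly_related (f g : nat -> nat) : Prop := poly_le f g /\ poly_le g f.

Definition negligible (f : nat -> rat) : Prop :=
  forall c : nat, exists N : nat, forall n, (N <= n)%N -> f n < n%:R ^- c.

Definition stat_dist (T : finType) (P Q : T -> rat) : rat :=
  2^-1 * \sum_(a : T) `|P a - Q a|.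

Definition uniform (T : finType) : T -> rat := fun=> #|T|%:R^-1.
Arguments uniform T _ : clear implicits.

(* A computation may toss fair coins, draw uniform elements of [Z] and query
   an oracle [Z * Z -> Z]. *)
Inductive ocomp (Z A : Type) : Type :=
| Ret of A
| Toss of (bool -> ocomp Z A)
| Draw of (Z -> ocomp Z A)
| Ask of Z * Z & (Z -> ocomp Z A).
Arguments Ret {Z A} _.
Arguments Toss {Z A} _.
Arguments Draw {Z A} _.
Arguments Ask {Z A} _ _.

Fixpoint bind (Z A B : Type) (m : ocomp Z A) (f : A -> ocomp Z B) : ocomp Z B :=
  match m with
  | Ret a => f a
  | Toss k => Toss (fun b => bind (k b) f)
  | Draw k => Draw (fun z => bind (k z) f)
  | Ask x k => Ask x (fun z => bind (k z) f)
  end.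

Notation "'let*' x ':=' m 'in' k" := (bind m (fun x => k))
  (at level 200, x pattern, m at level 200, k at level 200,
   format "'[v' 'let*'  x  ':='  m  'in' '/' k ']'").

Definition draw {Z : Type} : ocomp Z Z := Draw Ret.
Definition ask {Z : Type} (x : Z * Z) : ocomp Z Z := Ask x Ret.

Fixpoint prob_with (Z : finType) (H : {ffun Z * Z -> Z}) (A : Type)
    (m : ocomp Z A) (P : pred A) : rat :=
  match m with
  | Ret a => (P a)%:R
  | Toss k => 2^-1 * \sum_(b : bool) prob_with H (k b) P
  | Draw k => #|Z|%:R^-1 * \sum_(z : Z) prob_with H (k z) P
  | Ask x k => prob_with H (k (H x)) P
  end.

(* The oracle is one uniformly random function, shared by everything that
   happens in [m]. *)
Definition prob (Z : finType) (A : Type) (m : ocomp Z A) (P : pred A) : rat :=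
  #|{ffun Z * Z -> Z}|%:R^-1 * \sum_(H : {ffun Z * Z -> Z}) prob_with H m P.

Fixpoint always_with (Z A : Type) (H : Z * Z -> Z) (m : ocomp Z A)
    (P : A -> Prop) : Prop :=
  match m with
  | Ret a => P a
  | Toss k => forall b, always_with H (k b) P
  | Draw k => forall z, always_with H (k z) P
  | Ask x k => always_with H (k (H x)) P
  end.

Definition always (Z : finType) (A : Type) (m : ocomp Z A) (P : A -> Prop) :=
  forall H : {ffun Z * Z -> Z}, always_with H m P.

(* [genc] is the bit representation through which algorithms access group
   elements. *)
Record prime_group := PrimeGroup {
  carrier :> finGroupType;
  gen : carrier;
  genc : carrier -> seq bool;
  gen_spans : <[gen]>%g = [set: carrier];
  prime_order : prime #|carrier|;
  genc_inj : injective genc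
}.

Section Protocol.

Variable G : prime_group.

Definition group_order : nat := #|G|.

(* [group_order] is prime, hence at least 2, so that this is the ring of
   integers modulo [group_order]. *)
Definition Zq : finType := 'Z_group_order.

Definition zadd (x y : Zq) : Zq := (x : 'Z_group_order) + (y : 'Z_group_order).

Definition gexp (x : G) (k : Zq) : G := (x ^+ (k : 'Z_group_order))%g.

Record browser := Browser {
  bstate : Type;
  commit : ocomp Zq (Zq * bstate);
  reveal : bstate -> G -> ocomp Zq (Zq * Zq)
}.

(* [None] is the failure symbol. *)
Record token := Token {
  tstate : Type;
  respond : Zq -> ocomp Zq (G * tstate);
  finish : tstate -> Zq * Zq -> ocomp Zq (option Zq)
}.

Definition view : Type := Zq * G * (Zq * Zq).

Record outcome := Outcome {
  transcript : view;
  public_key : G;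
  private_key : option Zq
}.

Definition execute (b : browser) (t : token) : ocomp Zq outcome :=
  let* (c, sb) := commit b in
  let* (V, st) := respond t c in
  let* (v, r) := reveal sb V in
  let* x := finish st (v, r) in
  Ret (Outcome (c, V, (v, r)) (V * gexp (gen G) v)%g x).

Definition honest_browser : browser := {|
  commit := let* v := draw in
            let* r := draw in
            let* c := ask (v, r) in
            Ret (c, (v, r));
  reveal vr _ := Ret vr
|}.

Definition honest_token : token := {|
  respond c := let* v' := draw in Ret (gexp (gen G) v', (c, v'));
  finish '(c, v') '(v, r) :=
    let* h := ask (v, r) in
    Ret (if h == c then Some (zadd v v') else None)
|}.

Definition never_fails (b : browser) : Prop :=
  always (execute b honest_token) (fun o => private_key o <> None).

End Protocol.

(* Algorithms are programs of Jones's WHILE language, whose data are binary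
   trees and in which each elementary command takes one step; its polynomial
   time is that of Turing machines (trees are shared, so that an assignment
   copies a pointer).  The language is extended with coin tosses, uniform
   sampling from Z_q, oracle queries, and the group operations, which as usual
   are charged one step each: the honest parties have to carry them out. *)

Inductive tree : Type := Leaf | Node of tree & tree.

Inductive expr : Type :=
| Var of nat
| Nil
| Pair of expr & expr
| Hd of expr
| Tl of expr.

Inductive cmd : Type :=
| Assign of nat & expr
| Seq of cmd & cmd
| If of expr & cmd & cmd
| While of expr & cmd
| Coin of nat
| Sample of nat
| Hash of nat & expr & expr
| GMul of nat & expr & expr
| GInv of nat & expr
| GExp of nat & expr & expr.

Definition mem : Type := nat -> tree.

Definition upd (m : mem) (i : nat) (t : tree) : mem :=
  fun j => if j == i then t else m j.

Fixpoint eval (m : mem) (e : expr) : tree :=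
  match e with
  | Var i => m i
  | Nil => Leaf
  | Pair e1 e2 => Node (eval m e1) (eval m e2)
  | Hd e1 => if eval m e1 is Node t _ then t else Leaf
  | Tl e1 => if eval m e1 is Node _ t then t else Leaf
  end.

Definition truth (t : tree) : bool := if t is Node _ _ then true else false.

Definition tree_of_bool (b : bool) : tree := if b then Node Leaf Leaf else Leaf.

Definition tree_of_bits (s : seq bool) : tree :=
  foldr (fun b t => Node (tree_of_bool b) t) Leaf s.

Fixpoint bits_of_tree (t : tree) : seq bool :=
  if t is Node h u then truth h :: bits_of_tree u else [::].

(* Little-endian, on [w] bits. *)
Definition bits_of_nat (w k : nat) : seq bool :=
  [seq odd (k %/ 2 ^ i) | i <- iota 0 w].

Definition nat_of_bits (s : seq bool) : nat :=
  foldr (fun (b : bool) k => (b + 2 * k)%N) 0%N s.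

Section Semantics.

Variable G : prime_group.

Definition qwidth : nat := (trunc_log 2 (group_order G)).+1.

Definition tree_of_Zq (z : Zq G) : tree :=
  tree_of_bits (bits_of_nat qwidth (z : 'Z_(group_order G))).

Definition tree_of_G (x : G) : tree := tree_of_bits (genc x).

(* Decoding is total, so that every message is an element of Z_q or of the
   group: numbers are reduced modulo q, and bit strings that do not represent
   any group element are read as the identity. *)
Definition Zq_of_tree (t : tree) : Zq G :=
  (nat_of_bits (bits_of_tree t))%:R : 'Z_(group_order G).

Definition G_of_tree (t : tree) : G :=
  odflt 1%g [pick x | genc x == bits_of_tree t].

(* A configuration consists of the commands still to be executed and the
   memory; it is final when no command is left. *)
Definition config : Type := seq cmd * mem.

Definition step (s : config) : ocomp (Zq G) config :=
  let m := s.2 in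
  if s.1 is c :: k then
    match c with
    | Assign i e => Ret (k, upd m i (eval m e))
    | Seq c1 c2 => Ret ([:: c1, c2 & k], m)
    | If e c1 c2 => Ret ((if truth (eval m e) then c1 else c2) :: k, m)
    | While e c1 => Ret (if truth (eval m e) then [:: c1, c & k] else k, m)
    | Coin i => Toss (fun b => Ret (k, upd m i (tree_of_bool b)))
    | Sample i => let* z := draw in Ret (k, upd m i (tree_of_Zq z))
    | Hash i e1 e2 =>
        let* h := ask (Zq_of_tree (eval m e1), Zq_of_tree (eval m e2)) in
        Ret (k, upd m i (tree_of_Zq h))
    | GMul i e1 e2 =>
        Ret (k, upd m i
          (tree_of_G (G_of_tree (eval m e1) * G_of_tree (eval m e2))%g))
    | GInv i e => Ret (k, upd m i (tree_of_G (G_of_tree (eval m e))^-1%g))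
    | GExp i e1 e2 =>
        Ret (k, upd m i
          (tree_of_G (gexp (G_of_tree (eval m e1)) (Zq_of_tree (eval m e2)))))
    end
  else Ret s.

Fixpoint run (T : nat) (s : config) : ocomp (Zq G) config :=
  if T is T'.+1 then let* s' := step s in run T' s' else Ret s.

Definition exec (T : nat) (c : cmd) (m : mem) : ocomp (Zq G) mem :=
  let* (_, m') := run T ([:: c], m) in Ret m'.

Definition halts (T : nat) (c : cmd) (m : mem) : Prop :=
  always (run T ([:: c], m)) (fun s => s.1 = [::]).

(* Every machine is given the security parameter in unary, q and g. *)
Definition start (n : nat) (inputs : seq tree) : mem :=
  nth Leaf ([:: iter n (Node Leaf) Leaf;
                tree_of_bits (bits_of_nat qwidth (group_order G));
                tree_of_G (gen G)] ++ inputs).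

Definition trees_of_view (w : view G) : seq tree :=
  let: (c, V, (v, r)) := w in
  [:: tree_of_Zq c; tree_of_G V; tree_of_Zq v; tree_of_Zq r].

Definition view_of_mem (m : mem) : view G :=
  (Zq_of_tree (m 0), G_of_tree (m 1), (Zq_of_tree (m 2), Zq_of_tree (m 3))).

End Semantics.

(* [clock n] is an upper bound on the running time for security parameter [n]:
   a machine is efficient only if it halts within its clock. *)
Record machine := Machine { code : cmd; clock : nat -> nat }.

Definition run_machine (G : prime_group) (n : nat) (M : machine)
    (inputs : seq tree) : ocomp (Zq G) mem :=
  exec G (clock M n) (code M) (start G n inputs).

(* A machine playing the browser keeps its memory between its two messages; the
   token's message is put in register 0.  Outgoing messages are read from
   registers 0 and 1. *)
Record browser_machine := BrowserMachine {
  commit_code : cmd;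
  reveal_code : cmd;
  bclock : nat -> nat
}.

Definition browser_of (G : prime_group) (n : nat) (B : browser_machine) :
    browser G := {|
  commit := let* m := exec G (bclock B n) (commit_code B) (start G n [::]) in
            Ret (Zq_of_tree G (m 0%N), m);
  reveal m V :=
    let* m' := exec G (bclock B n) (reveal_code B) (upd m 0 (tree_of_G V)) in
    Ret (Zq_of_tree G (m' 0%N), Zq_of_tree G (m' 1%N))
|}.

(* What a malicious token outputs at the end is irrelevant. *)
Definition token_of (G : prime_group) (n : nat) (T : machine) : token G := {|
  respond c := let* m := run_machine G n T [:: tree_of_Zq c] in
               Ret (G_of_tree G (m 0%N), tt);
  finish _ _ := Ret None
|}.

Definition simulate (G : prime_group) (n : nat) (S : machine) (X : G) :
    ocomp (Zq G) (view G) :=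
  let* m := run_machine G n S [:: tree_of_G X] in Ret (view_of_mem G m).

Definition distinguish (G : prime_group) (n : nat) (D : machine) (X : G)
    (w : view G) : ocomp (Zq G) bool :=
  let* m := run_machine G n D (tree_of_G X :: trees_of_view w) in
  Ret (truth (m 0%N)).

Section Efficiency.

Variable Gs : nat -> prime_group.

Definition efficient (M : machine) (I : nat -> Type)
    (input : forall n, I n -> seq tree) : Prop :=
  poly_bounded (clock M) /\
  forall n (i : I n),
    halts (Gs n) (clock M n) (code M) (start (Gs n) n (input n i)).

Definition efficient_token (T : machine) : Prop :=
  efficient T (fun n (c : Zq (Gs n)) => [:: tree_of_Zq c]).

Definition efficient_simulator (S : machine) : Prop :=
  efficient S (fun n (X : Gs n) => [:: tree_of_G X]).

Definition efficient_distinguisher (D : machine) : Prop :=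
  efficient D (fun n (Xw : Gs n * view (Gs n)) =>
                 tree_of_G Xw.1 :: trees_of_view Xw.2).

Definition efficient_browser (B : browser_machine) : Prop :=
  poly_bounded (bclock B) /\
  forall n,
    let G := Gs n in
    halts G (bclock B n) (commit_code B) (start G n [::]) /\
    forall V : G,
      always (let* m := exec G (bclock B n) (commit_code B) (start G n [::]) in
              run G (bclock B n) ([:: reveal_code B], upd m 0 (tree_of_G V)))
             (fun s => s.1 = [::]).

(* Real and simulated executions as seen by a distinguisher, which has access
   to the same oracle as everyone else and is also given the public key that is
   the input of the simulator. *)
Definition real_game (B : browser_machine) (D : machine) (n : nat) :
    ocomp (Zq (Gs n)) bool :=
  let* o := execute (browser_of (Gs n) n B) (honest_token (Gs n)) in
  distinguish n D (public_key o) (transcript o).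

Definition ideal_game (B : browser_machine) (S D : machine) (n : nat) :
    ocomp (Zq (Gs n)) bool :=
  let* o := execute (browser_of (Gs n) n B) (honest_token (Gs n)) in
  let* w := simulate n S (public_key o) in
  distinguish n D (public_key o) w.

End Efficiency.

(* Main.v *)
Require Import Defs.
From mathcomp Require Import all_boot all_order all_algebra all_fingroup.
From mathcomp Require Import cyclic zify ring lra.
Set Implicit Arguments.
Unset Strict Implicit.
Unset Printing Implicit Defensive.
Import Order.TTheory GRing.Theory Num.Theory.
Local Open Scope ring_scope.

(* Fix the oracle [H] and let [extract] be the value [v] in the first query of the
   browser's first phase whose answer is the commitment [c].  A browser that
   never fails for any oracle has always made such a query, since otherwise
   changing the oracle on the points not queried would make it fail.  If the
   browser later reveals another value, it has found a collision of [H], which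
   happens with probability at most [N ^ 2 / q] for [N] queries.  Otherwise the
   revealed value does not depend on the token's uniform [v'], whence the
   uniformity of the private key.  The simulator runs the first phase while
   logging its queries, extracts [v] from the log by evaluating the oracle again,
   which needs no control over the oracle, and runs the second phase on
   [V' = X * g ^ - v].  For an honest browser, the value of [H] at a uniform point
   [(v, r)] is independent of the rest of [H], and a token making [N] queries hits
   that point with probability at most [N / q ^ 2]. *)

Lemma dist_unit_interval (a b : rat) :
  0 <= a <= 1 -> 0 <= b <= 1 -> `|a - b| <= 1.
Proof.
by move=> /andP[? ?] /andP[? ?]; rewrite ler_norml; apply/andP; split; lra.
Qed.

(** * Averages over finite types *)

Definition avg (T : finType) (f : T -> rat) : rat :=
  #|T|%:R^-1 * \sum_(x : T) f x.

Section Average.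

Variable T : finType.
Implicit Types f g : T -> rat.

Lemma eq_avg f g : f =1 g -> avg f = avg g.
Proof. by move=> fg; rewrite /avg (eq_bigr _ (fun x _ => fg x)). Qed.

Lemma le_avg f g : (forall x, f x <= g x) -> avg f <= avg g.
Proof.
by move=> fg; rewrite ler_wpM2l ?invr_ge0 ?ler0n// ler_sum.
Qed.

Lemma avg_const c : (0 < #|T|)%N -> avg (fun _ : T => c) = c.
Proof.
move=> T0; rewrite /avg sumr_const -[c *+ _]mulr_natl mulKf//.
by rewrite pnatr_eq0 -lt0n.
Qed.

Lemma avgB f g : avg (fun x => f x - g x) = avg f - avg g.
Proof. by rewrite /avg sumrB mulrBr. Qed.

Lemma avgMl c f : avg (fun x => c * f x) = c * avg f.
Proof. by rewrite /avg -mulr_sumr mulrCA. Qed.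

Lemma avgMr c f : avg (fun x => f x * c) = avg f * c.
Proof. by rewrite /avg -mulr_suml mulrA. Qed.

Lemma avg_sum (I : finType) (f : I -> T -> rat) :
  avg (fun x => \sum_i f i x) = \sum_i avg (f i).
Proof. by rewrite /avg exchange_big mulr_sumr. Qed.

Lemma ler_norm_avg f : `|avg f| <= avg (fun x => `|f x|).
Proof.
rewrite /avg normrM ger0_norm ?invr_ge0 ?ler0n//.
by rewrite ler_wpM2l ?invr_ge0 ?ler0n// ler_norm_sum.
Qed.

Lemma avg_reindex (S : finType) (h : S -> T) (f : T -> rat) :
  bijective h -> avg f = avg (fun x => f (h x)).
Proof.
move=> bij_h; rewrite /avg (bij_eq_card bij_h).
by rewrite (reindex h)//; apply: onW_bij.
Qed.

End Average.

Lemma exchange_avg (S T : finType) (f : S -> T -> rat) :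
  avg (fun x => avg (f x)) = avg (fun y => avg (fun x => f x y)).
Proof.
by rewrite /avg -!mulr_sumr exchange_big mulrCA.
Qed.

Lemma avg_indicator (T : finType) (a : T) : avg (fun x => (x == a)%:R) = #|T|%:R^-1.
Proof.
rewrite /avg (bigD1 a)//= eqxx big1 ?addr0 ?mulr1// => x /negbTE->//.
Qed.

Lemma avg_pair (S T : finType) (f : S -> T -> rat) :
  avg (fun x => avg (f x)) = avg (fun p => f p.1 p.2).
Proof.
rewrite /avg -mulr_sumr pair_big/= mulrA card_prod natrM invfM; congr (_ * _).
Qed.

(** * Computations with a fixed oracle *)

Section Expectation.

Variable Z : finType.
Implicit Types (H : {ffun Z * Z -> Z}) (x : Z * Z) (l : seq (Z * Z)).

(** With a rational-valued function in place of the event of [prob_with], the expectation of a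
    sequence becomes a nested expectation. *)
Fixpoint expect H (A : Type) (m : ocomp Z A) (f : A -> rat) : rat :=
  match m with
  | Ret a => f a
  | Toss k => avg (fun b => expect H (k b) f)
  | Draw k => avg (fun z => expect H (k z) f)
  | Ask x k => expect H (k (H x)) f
  end.

Lemma probE (A : Type) (m : ocomp Z A) (P : pred A) :
  prob m P = avg (fun H => expect H m (fun a => (P a)%:R)).
Proof.
congr (_ * _); apply: eq_bigr => H _.
elim: m => //= [k IH|k IH]; rewrite /avg ?card_bool; congr (_ * _);
  by apply: eq_bigr => i _; rewrite IH.
Qed.

Lemma expect_bind H (A B : Type) (m : ocomp Z A) (k : A -> ocomp Z B) f :
  expect H (bind m k) f = expect H m (fun a => expect H (k a) f).
Proof. by elim: m => //= k' IH; apply: eq_avg. Qed.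

Lemma always_bind (A B : Type) (h : Z * Z -> Z) (m : ocomp Z A)
    (k : A -> ocomp Z B) P :
  always_with h (bind m k) P <->
  always_with h m (fun a => always_with h (k a) P).
Proof.
elim: m => //= [k' IH|k' IH]; split=> h0 b; exact/IH.
Qed.

Lemma always_sub (A : Type) (h : Z * Z -> Z) (m : ocomp Z A) (P Q : A -> Prop) :
  (forall a, P a -> Q a) -> always_with h m P -> always_with h m Q.
Proof. by move=> PQ; elim: m => //= [k IH hk b|k IH hk z|x k IH]; eauto. Qed.

Lemma always_and (A : Type) (h : Z * Z -> Z) (m : ocomp Z A) (P Q : A -> Prop) :
  always_with h m P -> always_with h m Q ->
  always_with h m (fun a => P a /\ Q a).
Proof. by elim: m => //= [k IH hP hQ b|k IH hP hQ z|x k IH hP hQ]; apply: IH. Qed.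

Lemma always_forall (A I : Type) (h : Z * Z -> Z) (m : ocomp Z A)
    (P : I -> A -> Prop) :
  (forall i, always_with h m (P i)) -> always_with h m (fun a => forall i, P i a).
Proof.
elim: m => //= [k IH hP b|k IH hP z|x k IH hP]; apply: IH => i; exact: hP.
Qed.

Lemma always_true (A : Type) (h : Z * Z -> Z) (m : ocomp Z A) (P : A -> Prop) :
  (forall a, P a) -> always_with h m P.
Proof. by move=> hP; elim: m => //=. Qed.

Lemma always_exists (A : Type) (h : Z * Z -> Z) (m : ocomp Z A) (P : A -> Prop) :
  Z -> always_with h m P -> exists a, P a.
Proof.
move=> z; elim: m => /= [a|k IH hk|k IH hk|x k IH hk]; first by exists a.
- exact: IH (hk true).
- exact: IH (hk z).
- exact: IH hk.
Qed.

Lemma le_expect H (A : Type) (m : ocomp Z A) f g :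
  always_with H m (fun a => f a <= g a) -> expect H m f <= expect H m g.
Proof.
elim: m => //= [k IH hk|k IH hk|x k IH]; last exact: IH.
- by apply: le_avg => b; apply: IH.
- by apply: le_avg => z; apply: IH.
Qed.

Lemma eq_expect_always H (A : Type) (m : ocomp Z A) f g :
  always_with H m (fun a => f a = g a) -> expect H m f = expect H m g.
Proof.
elim: m => //= [k IH hk|k IH hk|x k IH]; last exact: IH.
- by apply: eq_avg => b; apply: IH.
- by apply: eq_avg => z; apply: IH.
Qed.

Lemma eq_expect H (A : Type) (m : ocomp Z A) f g :
  f =1 g -> expect H m f = expect H m g.
Proof. by move=> fg; apply/eq_expect_always/always_true. Qed.

Lemma expectB H (A : Type) (m : ocomp Z A) f g :
  expect H m (fun a => f a - g a) = expect H m f - expect H m g.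
Proof. by elim: m => //= k IH; rewrite -avgB; apply: eq_avg. Qed.

Lemma expectMl H (A : Type) (m : ocomp Z A) c f :
  expect H m (fun a => c * f a) = c * expect H m f.
Proof. by elim: m => //= k IH; rewrite -avgMl; apply: eq_avg. Qed.

Lemma expect_sum H (A : Type) (m : ocomp Z A) (I : finType) (f : I -> A -> rat) :
  expect H m (fun a => \sum_i f i a) = \sum_i expect H m (f i).
Proof. by elim: m => //= k IH; rewrite -avg_sum; apply: eq_avg. Qed.

Lemma expect_avg H (A : Type) (m : ocomp Z A) (I : finType) (f : I -> A -> rat) :
  expect H m (fun a => avg (fun i => f i a)) = avg (fun i => expect H m (f i)).
Proof. by rewrite expectMl expect_sum. Qed.

Lemma ler_norm_expect H (A : Type) (m : ocomp Z A) f :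
  `|expect H m f| <= expect H m (fun a => `|f a|).
Proof.
elim: m => //= k IH; apply: (le_trans (ler_norm_avg _)); exact: le_avg.
Qed.

Hypothesis Z_gt0 : (0 < #|Z|)%N.

Lemma expect_const H (A : Type) (m : ocomp Z A) c : expect H m (fun=> c) = c.
Proof.
elim: m => //= k IH; rewrite (eq_avg IH) avg_const ?card_bool//.
Qed.

Lemma expect_ge0 H (A : Type) (m : ocomp Z A) f :
  (forall a, 0 <= f a) -> 0 <= expect H m f.
Proof.
by move=> f0; rewrite -(expect_const H m 0); apply/le_expect/always_true.
Qed.

Lemma expect_le1 H (A : Type) (m : ocomp Z A) f :
  (forall a, f a <= 1) -> expect H m f <= 1.
Proof.
by move=> f1; rewrite -(expect_const H m 1); apply/le_expect/always_true.
Qed.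

(** The bound ranges over all sequences of answers, even those that no function gives, and so does
    not refer to an oracle. *)
Fixpoint query_bound (A : Type) (N : nat) (m : ocomp Z A) : Prop :=
  match m with
  | Ret _ => True
  | Toss k => forall b, query_bound N (k b)
  | Draw k => forall z, query_bound N (k z)
  | Ask _ k => if N is N'.+1 then forall z, query_bound N' (k z) else False
  end.

Lemma query_bound_leq (A : Type) (M N : nat) (m : ocomp Z A) :
  (M <= N)%N -> query_bound M m -> query_bound N m.
Proof.
elim: m M N => //= [k IH M N MN hm b|k IH M N MN hm z|x k IH [|M] [|N]//= MN hm z].
- exact: IH (hm b).
- exact: IH (hm z).
- exact: IH (hm z).
Qed.

Lemma query_bound_bind (A B : Type) (M N : nat) (m : ocomp Z A)
    (k : A -> ocomp Z B) :
  query_bound M m -> (forall a, query_bound N (k a)) ->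
  query_bound (M + N) (bind m k).
Proof.
move=> + hk; elim: m M => //= [a M _|k' IH M hm b|k' IH M hm z|x k' IH [|M]//= hm z].
- exact/(query_bound_leq (leq_addl M N))/hk.
- exact: IH.
- exact: IH.
- exact: IH.
Qed.

Definition reprogram H x z : {ffun Z * Z -> Z} :=
  [ffun y => if y == x then z else H y].

(** Exchanging a fresh value [z] with [H x] is an involution on the pairs [(z, H)], so resampling
    one answer keeps the oracle uniform. *)
Lemma avg_reprogram x (F : {ffun Z * Z -> Z} -> rat) :
  avg F = avg (fun z => avg (fun H => F (reprogram H x z))).
Proof.
have swapK : bijective (fun p : Z * {ffun Z * Z -> Z} =>
    (p.2 x, reprogram p.2 x p.1)).
  exists (fun p : Z * {ffun Z * Z -> Z} => (p.2 x, reprogram p.2 x p.1)) => -[z H];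
  rewrite /= !ffunE eqxx; congr (_, _); apply/ffunP => y; rewrite !ffunE;
  by case: eqP => // ->.
by rewrite -(avg_const (avg F) Z_gt0) !avg_pair (avg_reindex _ swapK).
Qed.

(* Only the runs that query [x] can notice the change, and each run queries at
   most [N] points. *)
Lemma sum_reprogram H (z : Z) (A : Type) (N : nat) (m : ocomp Z A)
    (f : Z * Z -> A -> rat) :
  (forall x a, 0 <= f x a <= 1) -> query_bound N m ->
  \sum_x `|expect (reprogram H x z) m (f x) - expect H m (f x)| <= N%:R.
Proof.
move=> f01; elim: m N => /= [a N _|k IH N hm|k IH N hm|y k IH [|N]//= hm].
- by rewrite big1 ?ler0n// => x _; rewrite subrr normr0.
- rewrite -[leRHS](@avg_const bool) ?card_bool//.
  under eq_bigr do rewrite -avgB.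
  apply: (le_trans (ler_sum _ (fun x _ => ler_norm_avg _))).
  by rewrite -avg_sum; apply: le_avg => b; apply: IH.
- rewrite -[leRHS](avg_const _ Z_gt0).
  under eq_bigr do rewrite -avgB.
  apply: (le_trans (ler_sum _ (fun x _ => ler_norm_avg _))).
  by rewrite -avg_sum; apply: le_avg => b; apply: IH.
(* The term of the queried point [y] costs at most 1; at every other [x] the reprogrammed oracle
   answers [y] as [H] does, and induction covers the remaining queries. *)
- rewrite (bigD1 y)//= -natr1 addrC lerD//; last first.
    by apply: dist_unit_interval;
      rewrite expect_ge0 ?expect_le1// => a; case/andP: (f01 y a).
  apply: le_trans (IH (H y) N (hm _)); rewrite [leRHS](bigD1 y)//=.
  rewrite -[leLHS]add0r lerD//; apply: ler_sum => x xy.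
  by rewrite ffunE eq_sym (negbTE xy).
Qed.

(** The log lists the latest query first; it starts from [l] so that a run can extend the log of an
    earlier one. *)
Fixpoint logged (A : Type) l (m : ocomp Z A) : ocomp Z (A * seq (Z * Z)) :=
  match m with
  | Ret a => Ret (a, l)
  | Toss k => Toss (fun b => logged l (k b))
  | Draw k => Draw (fun z => logged l (k z))
  | Ask x k => Ask x (fun z => logged (x :: l) (k z))
  end.

Lemma expect_logged H (A : Type) l (m : ocomp Z A) (f : A -> rat) :
  expect H (logged l m) (fun p => f p.1) = expect H m f.
Proof. by elim: m l => //= k IH l; apply: eq_avg. Qed.

Lemma always_logged (h : Z * Z -> Z) (A : Type) l (m : ocomp Z A) (P : A -> Prop) :
  always_with h m P -> always_with h (logged l m) (fun p => P p.1).
Proof. by elim: m l => //= [k IH|k IH|x k IH] l hm => [b|z|]; apply: IH. Qed.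

Lemma expect_logged_bind H (A B : Type) l (m : ocomp Z A) (k : A -> ocomp Z B) f :
  expect H (logged l (bind m k)) f =
  expect H (logged l m) (fun p => expect H (logged p.2 (k p.1)) f).
Proof. by elim: m l => //= k' IH l; apply: eq_avg. Qed.

Lemma logged_sub (h : Z * Z -> Z) (A : Type) l (m : ocomp Z A) :
  always_with h (logged l m) (fun p => {subset l <= p.2}).
Proof.
elim: m l => //= [_ l p //|x k IH l].
apply: always_sub (IH (h x) (x :: l)) => p hp y yl.
by apply: hp; rewrite inE yl orbT.
Qed.

Lemma logged_size (h : Z * Z -> Z) (A : Type) N l (m : ocomp Z A) :
  query_bound N m -> always_with h (logged l m) (fun p => size p.2 <= N + size l)%N.
Proof.
elim: m N l => /= [a|k IH|k IH|x k IH] N l.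
- by rewrite leq_addl.
- by move=> hm b; apply: IH.
- by move=> hm z; apply: IH.
- case: N => // N hm; apply: always_sub (IH (h x) N (x :: l) (hm _)) => p /=.
  by rewrite addnS.
Qed.

(* A run with oracle [H] is also a run of every oracle that agrees with [H] on
   the queries made. *)
Lemma logged_replay (A : Type) l (m : ocomp Z A)
    (Q : A -> seq (Z * Z) -> {ffun Z * Z -> Z} -> Prop) H :
  (forall H', {in l, H =1 H'} ->
     always_with H' (logged l m) (fun p => Q p.1 p.2 H')) ->
  always_with H (logged l m)
    (fun p => forall H', {in p.2, H =1 H'} -> Q p.1 p.2 H').
Proof.
elim: m l => //= [k IH|k IH|x k IH] l hQ => [b|z|]; apply: IH => H' HH'.
- exact: hQ.
- exact: hQ.
- rewrite (HH' x) ?mem_head//; apply: hQ => y yl; apply: HH'.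
  by rewrite inE yl orbT.
Qed.

(** [undup] keeps a repeated query from counting as a collision. *)
Definition collides H l := ~~ uniq (map H (undup l)).

Lemma collidesP H l x y :
  x \in l -> y \in l -> x != y -> H x = H y -> collides H l.
Proof.
rewrite -[x \in l]mem_undup -[y \in l]mem_undup /collides.
elim: (undup l) => //= a s IH; rewrite !inE => /orP[/eqP->|xs] /orP[/eqP->|ys] xy Hxy.
- by rewrite eqxx in xy.
- by rewrite Hxy map_f.
- by rewrite -Hxy map_f.
- by rewrite negb_and IH ?orbT.
Qed.

(** Resampling [H] at the unlogged point [x] changes neither the weight nor the logged answers, of
    which there are at most [size l] for the fresh value to hit. *)
Lemma avg_hit (w : {ffun Z * Z -> Z} -> rat) x l :
  (forall H, 0 <= w H) ->
  (forall H H', {in l, H =1 H'} -> w H = w H') -> x \notin l ->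
  avg (fun H => w H * (H x \in map H (undup l))%:R) <=
  avg w * ((size l)%:R / #|Z|%:R).
Proof.
move=> w0 wl xl; rewrite (avg_reprogram x) exchange_avg.
have keep H z : {in l, H =1 reprogram H x z}.
  by move=> y yl; rewrite ffunE; case: eqP => // yx; rewrite -yx yl in xl.
rewrite mulrC -avgMl; apply: le_avg => H.
rewrite [leRHS]mulrC.
under eq_avg => z.
  rewrite -(wl H)//.
  have -> : map (reprogram H x z) (undup l) = map H (undup l).
    by apply/esym/eq_in_map => y; rewrite mem_undup; apply: keep.
  rewrite ffunE eqxx; over.
rewrite avgMl ler_wpM2l// mulrC ler_wpM2l ?invr_ge0 ?ler0n//.
rewrite -natr_sum ler_nat -big_mkcond sum1_card /=.
apply: (leq_trans (card_size _)); rewrite size_map; exact: size_undup.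
Qed.

(** The weight [w] stands for the indicator of the answers received so far, which depends on the
    logged points only. A query made with a log of length [s] adds at most [s / #|Z|], and
    [s < size l + N] at each of the [N] queries. *)
Lemma collision_bound (A : Type) N l (m : ocomp Z A) w :
  query_bound N m -> (forall H, 0 <= w H) ->
  (forall H H', {in l, H =1 H'} -> w H = w H') ->
  avg (fun H => w H * expect H (logged l m) (fun p => (collides H p.2)%:R)) <=
  avg (fun H => w H * (collides H l)%:R) +
  avg w * ((N * (size l + N))%:R / #|Z|%:R).
Proof.
elim: m N l w => /= [a|k IH|k IH|x k IH] N l w hm w0 wl; last case: N hm => //= N hm.
- rewrite lerDl mulr_ge0 ?divr_ge0 ?ler0n//.
  by rewrite mulr_ge0 ?invr_ge0 ?ler0n// sumr_ge0.
- under eq_avg do rewrite -avgMl.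
  rewrite exchange_avg -[leRHS](@avg_const bool) ?card_bool//.
  by apply: le_avg => b; apply: IH.
- under eq_avg do rewrite -avgMl.
  rewrite exchange_avg -[leRHS](avg_const _ Z_gt0).
  by apply: le_avg => b; apply: IH.
(* What follows depends on the answer, so the average is split over its value [z]; the event
   [H x = z] then joins the weight. *)
have splitE (F : Z -> {ffun Z * Z -> Z} -> rat) :
    avg (fun H => w H * F (H x) H) =
    \sum_z avg (fun H => w H * (H x == z)%:R * F z H).
  rewrite -avg_sum; apply: eq_avg => H; rewrite (bigD1 (H x))//= eqxx mulr1.
  rewrite big1 ?addr0// => z; rewrite eq_sym => /negbTE ->.
  by rewrite mulr0 mul0r.
rewrite (splitE (fun z H => expect H (logged (x :: l) (k z)) _)).
have step z : avg (fun H => w H * (H x == z)%:R *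
      expect H (logged (x :: l) (k z)) (fun p => (collides H p.2)%:R)) <=
    avg (fun H => w H * (H x == z)%:R * (collides H (x :: l))%:R) +
    avg (fun H => w H * (H x == z)%:R * ((N * ((size l).+1 + N))%:R / #|Z|%:R)).
  apply: (le_trans (IH z N (x :: l) (fun H => w H * (H x == z)%:R) (hm z) _ _)).
  - by move=> H; rewrite mulr_ge0 ?ler0n.
  - move=> H H' HH'; rewrite (HH' x) ?mem_head// (wl H H')// => y yl.
    by apply: HH'; rewrite inE yl orbT.
  - by rewrite avgMr.
apply: (le_trans (ler_sum _ (fun z _ => step z))).
rewrite big_split/= -(splitE (fun _ H => (collides H (x :: l))%:R)).
rewrite -(splitE (fun _ _ => _)).
rewrite avgMr.
have w_ge0 : 0 <= avg w by rewrite mulr_ge0 ?invr_ge0 ?ler0n// sumr_ge0.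
(* A repeated point creates no collision; a new one does so only if its answer hits an earlier
   one. *)
have hcoll : avg (fun H => w H * (collides H (x :: l))%:R) <=
    avg (fun H => w H * (collides H l)%:R) + avg w * ((size l)%:R / #|Z|%:R).
  have [xl|xl] := boolP (x \in l).
    rewrite [leLHS](_ : _ = avg (fun H => w H * (collides H l)%:R)).
      by rewrite lerDl mulr_ge0// divr_ge0 ?ler0n.
    by apply: eq_avg => H; rewrite /collides /= xl.
  rewrite -[leLHS]subr0 lerBlDl add0r -[leRHS]addrC -lerBlDr -avgB.
  apply: le_trans (avg_hit w0 wl xl); apply: le_avg => H.
  rewrite -mulrBr ler_wpM2l// /collides /= (negbTE xl) /=.
  by case: (H x \in _); case: (uniq _).
apply: (le_trans (lerD hcoll (lexx _))); rewrite -addrA -mulrDr -mulrDl -natrD.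
rewrite lerD2l ler_wpM2l// ler_wpM2r ?invr_ge0 ?ler0n// ler_nat; nia.
Qed.

End Expectation.

(** * The protocol *)

Section Group.

Variable G : prime_group.

Let q := group_order G.

Lemma group_order_gt1 : (1 < q)%N.
Proof. exact/prime_gt1/prime_order. Qed.

Lemma card_Zq : #|Zq G| = q.
Proof. by rewrite card_ord Zp_cast ?group_order_gt1. Qed.

Lemma card_Zq_gt0 : (0 < #|Zq G|)%N.
Proof. by rewrite card_Zq ltnW ?group_order_gt1. Qed.

Lemma order_gen : #[gen G]%g = q.
Proof. by rewrite orderE gen_spans cardsT. Qed.

Lemma gexpD (x : G) (a b : Zq G) : gexp x (zadd a b) = (gexp x a * gexp x b)%g.
Proof.
have xq : (x ^+ q)%g = 1%g by rewrite /q /group_order -cardsT expg_cardG ?inE.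
rewrite /gexp /zadd /= -expgD -(expg_mod (a + b) xq).
by congr (_ ^+ (_ %% _))%g; apply: Zp_cast group_order_gt1.
Qed.

Lemma gexp_gen_bij : bijective (gexp (gen G)).
Proof.
apply: inj_card_bij; last by rewrite card_Zq.
move=> a b /eqP; rewrite eq_expg_mod_order order_gen => /eqP.
have lt_q (z : Zq G) : (z < q)%N.
  by rewrite -[X in (_ < X)%N](Zp_cast group_order_gt1) ltn_ord.
by rewrite !modn_small// => ab; apply: val_inj.
Qed.

Lemma zaddr_bij (a : Zq G) : bijective (fun z : Zq G => zadd z a).
Proof.
by exists (fun z : Zq G => (z : 'Z_q) - (a : 'Z_q)) => z; rewrite /zadd ?addrK ?subrK.
Qed.

Lemma zaddC (a b : Zq G) : zadd a b = zadd b a.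
Proof. exact: addrC. Qed.

End Group.

(** * The public key of an honest browser *)

Section HonestBrowser.

Variables (G : prime_group) (t : token G) (N : nat).
Hypothesis t_queries : forall c, query_bound N (respond t c).

(** Resampling the oracle at the browser's point [x] turns the commitment into an independent [z]
    and makes the token face [H] reprogrammed at [x]. Against [H] itself, the token's answer would
    be independent of [x] and the key exactly uniform. By [sum_reprogram], the difference is at most
    [N / q ^ 2] for each of the [q] keys. *)
Lemma honest_browser_bias :
  stat_dist
    (fun X : G => prob (execute (honest_browser G) t) (fun o => public_key o == X))
    (uniform G) <= N%:R / #|G|%:R.
Proof.
pose q := group_order G; have Z0 := card_Zq_gt0 G.
have q0 : (0 : rat) < q%:R by rewrite ltr0n ltnW ?group_order_gt1.
have cardZ : #|Zq G|%:R = q%:R :> rat by rewrite card_Zq.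
pose f (X : G) (x : Zq G * Zq G) (Vs : G * tstate t) : rat :=
  ((Vs.1 * gexp (gen G) x.1)%g == X)%:R.
have pair_avg (F : Zq G * Zq G -> rat) : avg (fun v => avg (fun r => F (v, r))) = avg F.
  by rewrite avg_pair; apply: eq_avg => -[].
have probE' X :
    prob (execute (honest_browser G) t) (fun o => public_key o == X) =
    avg (fun z => avg (fun H => avg (fun x =>
      expect (reprogram H x z) (respond t z) (f X x)))).
  rewrite probE.
  transitivity (avg (fun H : {ffun Zq G * Zq G -> Zq G} => avg (fun x : Zq G * Zq G =>
      expect H (respond t (H x)) (f X x)))).
    apply: eq_avg => H; rewrite -pair_avg /=.
    apply: eq_avg => v; apply: eq_avg => r; rewrite expect_bind.
    by apply: eq_expect => -[V st] /=; rewrite expect_bind /= expect_const.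
  rewrite [LHS]exchange_avg; under [LHS]eq_avg => x.
    rewrite (avg_reprogram Z0 x).
    under eq_avg do under eq_avg do rewrite ffunE eqxx.
    over.
  rewrite [LHS]exchange_avg; apply: eq_avg => z; exact: exchange_avg.
(* For a fixed token message, the average over [v] is an average over the whole group, through the
   bijection [gexp (gen G)] and a translation. *)
have uniformE X :
    uniform G X = avg (fun z => avg (fun H : {ffun Zq G * Zq G -> Zq G} => avg (fun x =>
      expect H (respond t z) (f X x)))).
  under eq_avg => z.
    under eq_avg => H.
      rewrite -expect_avg.
      under eq_expect => Vs.
        rewrite -pair_avg /f.
        under eq_avg do rewrite /= avg_const//.
        rewrite (_ : avg _ = #|G|%:R^-1); last first.
          have bij_shift : bijective (fun y : G => (Vs.1 * y)%g).
            by exists (fun y => Vs.1^-1 * y)%g => y; rewrite mulgA ?mulVg ?mulgV mul1g.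
          rewrite -(avg_indicator X) (avg_reindex _ bij_shift).
          by rewrite (avg_reindex _ (gexp_gen_bij G)).
        over.
      rewrite expect_const//; over.
    rewrite avg_const; last by apply/card_gt0P; exists [ffun=> z].
    over.
  by rewrite avg_const.
have bound X :
    `|prob (execute (honest_browser G) t) (fun o => public_key o == X) - uniform G X| <=
    N%:R / (q%:R * q%:R).
  rewrite probE' uniformE -avgB -[leRHS](@avg_const (Zq G))//.
  apply: (le_trans (ler_norm_avg _)); apply: le_avg => z.
  rewrite -avgB -[leRHS](@avg_const {ffun Zq G * Zq G -> Zq G}); last first.
    by apply/card_gt0P; exists [ffun=> z].
  apply: (le_trans (ler_norm_avg _)); apply: le_avg => H.
  rewrite -avgB; apply: (le_trans (ler_norm_avg _)).
  rewrite /avg card_prod natrM cardZ mulrC ler_pM2r ?invr_gt0 ?mulr_gt0//.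
  apply: sum_reprogram => // x a; rewrite /f; case: (_ == _) => //=.
rewrite /stat_dist; apply: (@le_trans _ _ (2^-1 * \sum_(X : G) N%:R / (q%:R * q%:R))).
  by rewrite ler_pM2l ?invr_gt0//; apply: ler_sum => X _; apply: bound.
rewrite sumr_const -[_ *+ _]mulr_natr -/(group_order G) -/q.
rewrite [X in 2^-1 * X](_ : _ = N%:R / q%:R); last by field; rewrite lt0r_neq0.
rewrite -[leRHS]mul1r ler_wpM2r// divr_ge0 ?ler0n//.
Qed.

End HonestBrowser.

(** * Extraction, key uniformity and simulation for an honest token *)

Section HonestToken.

Variables (G : prime_group) (b : browser G) (M N : nat).
Hypothesis commit_queries : query_bound M (commit b).
Hypothesis reveal_queries : forall s V, query_bound N (reveal (b := b) s V).
Hypothesis b_never_fails : never_fails b.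

Notation Z := (Zq G).
Notation oracle := {ffun Z * Z -> Z}.
Implicit Types (H : oracle) (l : seq (Z * Z)).

(** Logs list the latest query first, so the last match of the fold is the earliest query; [v] is
    the default. *)
Definition extract H (c v : Z) l : Z :=
  foldl (fun v p => if H p == c then p.1 else v) v l.

Lemma extractP H c v l :
  (exists2 x, x \in l & H x = c) ->
  exists r, (extract H c v l, r) \in l /\ H (extract H c v l, r) = c.
Proof.
(* The induction is over all defaults: either nothing matches and the default survives, or the
   result comes from a matching entry. *)
have: (extract H c v l = v /\ forall x, x \in l -> H x != c) \/
    exists r, (extract H c v l, r) \in l /\ H (extract H c v l, r) = c.
  elim: l v => /= [|x l IH] v; first by left.
  have [Hx|Hx] := eqVneq (H x) c.
    right; case: (IH x.1) => [[-> _]|[r [rl Hr]]].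
      by exists x.2; rewrite -surjective_pairing mem_head.
    by exists r; rewrite inE rl orbT.
  case: (IH v) => [[-> hl]|[r [rl Hr]]]; last first.
    by right; exists r; rewrite inE rl orbT.
  by left; split=> // y; rewrite inE => /orP[/eqP->|/hl].
by case=> // -[_ hl] [x /hl/eqP].
Qed.

(** The protocol up to the token's check, exposing the token's exponent and the log of the first
    phase. *)
Definition session : ocomp Z (Z * bstate b * seq (Z * Z) * Z * (Z * Z)) :=
  bind (logged [::] (commit b)) (fun p =>
  bind draw (fun v' =>
  bind (reveal p.1.2 (gexp (gen G) v')) (fun vr => Ret (p, v', vr)))).

(** The default is what the simulator decodes from a register set to [Nil]. *)
Definition guess H (p : Z * bstate b * seq (Z * Z)) : Z :=
  extract H p.1.1 (Zq_of_tree G Leaf) p.2.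

Definition misguessed H (o : Z * bstate b * seq (Z * Z) * Z * (Z * Z)) : bool :=
  o.2.1 != guess H o.1.1.

Lemma expect_session H f :
  expect H session f =
  expect H (logged [::] (commit b)) (fun p => avg (fun v' =>
    expect H (reveal p.1.2 (gexp (gen G) v')) (fun vr => f (p, v', vr)))).
Proof.
rewrite expect_bind; apply: eq_expect => p /=; apply: eq_avg => v'.
exact: expect_bind.
Qed.

Lemma expect_execute H f :
  expect H (execute b (honest_token G)) f =
  expect H session (fun o => let: (p, v', vr) := o in
    f (Outcome (p.1.1, gexp (gen G) v', vr)
               (gexp (gen G) v' * gexp (gen G) vr.1)%g
               (if H vr == p.1.1 then Some (zadd vr.1 v') else None))).
Proof.
rewrite expect_session expect_bind -(expect_logged H [::]).
apply: eq_expect => -[[c s] l] /=; apply: eq_avg => v'; rewrite expect_bind.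
by apply: eq_expect => -[v r].
Qed.

Lemma reveal_opens H :
  always_with H (commit b) (fun cs => forall v' : Z,
    always_with H (reveal cs.2 (gexp (gen G) v')) (fun vr => H vr = cs.1)).
Proof.
have /always_bind := b_never_fails H; apply: always_sub => -[c s] /= h v'.
move/always_bind: (h v'); apply: always_sub => -[v r] /=.
by case: eqP.
Qed.

(** By replay, the first phase has the same run under an oracle that agrees with [H] on the log and
    avoids [c] elsewhere. The browser must still succeed there, so its opening is a logged point. *)
Lemma committed_preimage H :
  always_with H (logged [::] (commit b))
    (fun p => exists2 x, x \in p.2 & H x = p.1.1).
Proof.
have := logged_replay (Q := fun cs l H' => forall v' : Z,
  always_with H' (reveal cs.2 (gexp (gen G) v')) (fun vr => H' vr = cs.1))
  (l := [::]) (m := commit b) (H := H).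
move=> /(_ (fun H' _ => always_logged _ (reveal_opens H'))).
apply: always_sub => -[[c s] l] /=.
(* Off the log the value is [c + 1], which differs from [c] since 1 is nonzero modulo [q]. *)
pose H' : oracle := [ffun x => if x \in l then H x
  else zadd c ((1 : 'Z_(group_order G)) : Z)].
have HH' : {in l, H =1 H'} by move=> x xl; rewrite ffunE xl.
move/(_ H' HH' (Zq_of_tree G Leaf)) => /(always_exists (Zq_of_tree G Leaf)) [x].
rewrite ffunE; case: ifP => [xl Hx|_]; first by exists x.
move/(congr1 (fun z : 'Z_(group_order G) => z - (c : 'Z_(group_order G)))).
by rewrite /zadd addrC addKr subrr => /eqP; rewrite oner_eq0.
Qed.

Definition misguess_prob : rat :=
  avg (fun H : oracle => expect H session (fun o => (misguessed H o)%:R)).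

(* If the revealed value differs from the extracted one, two different queries
   have the commitment as answer. *)
Lemma misguess_bound :
  misguess_prob <= ((M + N).+1 ^ 2)%:R / #|G|%:R.
Proof.
(* The final query at the revealed pair puts that pair into the log; it accounts for the successor
   in the bound. *)
pose m : ocomp Z Z := bind (commit b) (fun cs => Draw (fun v' =>
  bind (reveal cs.2 (gexp (gen G) v')) (fun vr => Ask vr Ret))).
have m_queries : query_bound (M + N).+1 m.
  rewrite -addnS; apply: query_bound_bind => // cs v'; rewrite -addn1.
  by apply: query_bound_bind.
have := collision_bound (card_Zq_gt0 G) (l := [::]) (w := fun=> 1) m_queries
  (fun=> ler01) (fun _ _ _ => erefl).
rewrite (_ : avg (fun=> 1 * (collides _ [::])%:R) = 0); last first.
  by rewrite /avg big1 ?mulr0// => H _; rewrite mul1r.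
rewrite add0r avg_const; last by apply/card_gt0P; exists [ffun=> Zq_of_tree G Leaf].
rewrite mul1r add0n -[X in _ -> _ <= _ / X%:R]card_Zq mulnn.
apply: le_trans; apply: le_avg => H; rewrite mul1r.
rewrite expect_session expect_logged_bind; apply: le_expect.
have := always_and (committed_preimage H) (always_logged [::] (reveal_opens H)).
apply: always_sub => -[[c s] l] [/= pre opens]; apply: le_avg => v'.
rewrite -(expect_logged H l) expect_logged_bind; apply: le_expect.
have := always_and (always_logged l (opens v')) (logged_sub H l _).
apply: always_sub => -[[v r] l'] [/= Hvr ll']; rewrite ler_nat.
rewrite /misguessed /guess /=.
have [r' []] := extractP (Zq_of_tree G Leaf) pre.
set e := extract _ _ _ _ => el He; case: eqVneq => //= ve.
have -> // : collides H ((v, r) :: l').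
apply: (@collidesP _ _ _ (v, r) (e, r')); rewrite ?mem_head ?He//.
  by rewrite inE ll' ?orbT.
by apply: contra ve => /eqP[->].
Qed.

(** The guess is fixed before [v'] is drawn, so their sum is exactly uniform. The private key equals
    this sum unless the guess is wrong, and the distance between two coupled variables is at most
    the probability that they differ. *)
Lemma honest_token_bias :
  stat_dist
    (fun x : Z => prob (execute b (honest_token G)) (fun o => private_key o == Some x))
    (uniform Z) <= misguess_prob.
Proof.
have Z0 := card_Zq_gt0 G.
have H0 : (0 < #|{: oracle}|)%N.
  by apply/card_gt0P; exists [ffun=> Zq_of_tree G Leaf].
have opens H : always_with H session (fun o => H o.2 = o.1.1.1.1).
  apply/always_bind; apply: always_sub (always_logged _ (reveal_opens H)) => p h v'.
  by apply/always_bind; apply: always_sub (h v').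
pose key (o : Z * bstate b * seq (Z * Z) * Z * (Z * Z)) := zadd o.2.1 o.1.2.
pose key' H (o : Z * bstate b * seq (Z * Z) * Z * (Z * Z)) :=
  zadd (guess H o.1.1) o.1.2.
have probE' x : prob (execute b (honest_token G)) (fun o => private_key o == Some x) =
    avg (fun H : oracle => expect H session (fun o => (key o == x)%:R)).
  rewrite probE; apply: eq_avg => H; rewrite expect_execute.
  apply: eq_expect_always; apply: always_sub (opens H) => -[[p v'] vr] /= ->.
  by rewrite eqxx.
have uniformE x : uniform Z x =
    avg (fun H : oracle => expect H session (fun o => (key' H o == x)%:R)).
  rewrite -(avg_const (uniform Z x) H0); apply: eq_avg => H; rewrite expect_session.
  rewrite -[LHS](expect_const Z0 H (logged [::] (commit b))).
  apply: eq_expect => p; rewrite /uniform -(avg_indicator x).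
  rewrite (avg_reindex _ (zaddr_bij (guess H p))).
  by apply: eq_avg => v'; rewrite /key' /= expect_const// zaddC.
have two_neq0 : (2 : rat) != 0 by rewrite pnatr_eq0.
(* On a wrong guess the two indicator functions are at total distance at most 2, which cancels the
   factor 1/2 of [stat_dist]. *)
rewrite /stat_dist -[leRHS](mulKf two_neq0) ler_pM2l ?invr_gt0 ?ltr0n// -avgMl.
apply: (@le_trans _ _ (\sum_x avg (fun H : oracle => expect H session (fun o =>
    `|(key o == x)%:R - (key' H o == x)%:R|)))).
  apply: ler_sum => x _; rewrite probE' uniformE -avgB.
  apply: (le_trans (ler_norm_avg _)); apply: le_avg => H.
  by rewrite -expectB; apply: ler_norm_expect.
rewrite -avg_sum; apply: le_avg => H; rewrite -expect_sum -expectMl.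
apply/le_expect/always_true => o; rewrite /misguessed.
case: eqVneq => /= [o_guess|_].
  by rewrite mulr0 big1// => x _; rewrite /key /key' o_guess subrr normr0.
rewrite mulr1; apply: (@le_trans _ _ (\sum_x ((key o == x)%:R + (key' H o == x)%:R))).
  by apply: ler_sum => x _; rewrite (le_trans (ler_normB _ _))// !ger0_norm ?ler0n.
rewrite big_split /=.
have one (a : Z) : \sum_x (a == x)%:R = 1 :> rat.
  by rewrite (bigD1 a)//= eqxx big1 ?addr0// => x; rewrite eq_sym => /negbTE ->.
by rewrite !one.
Qed.

(** The simulator as an expectation, independent of the machine that will implement it. *)
Definition simulated H (X : G) (f : view G -> rat) : rat :=
  expect H (logged [::] (commit b)) (fun p =>
    let V := (X * (gexp (gen G) (guess H p))^-1)%g in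
    expect H (reveal p.1.2 V) (fun vr => f (p.1.1, V, vr))).

(* Both sides are compared to the variants in which the extracted value is used
   instead of the revealed one; these two are equal, by a translation of [v']. *)
Lemma simulation_error (Phi : oracle -> G -> view G -> rat) :
  (forall H X w, 0 <= Phi H X w <= 1) ->
  `|avg (fun H => expect H (execute b (honest_token G))
            (fun o => Phi H (public_key o) (transcript o))) -
    avg (fun H => expect H (execute b (honest_token G))
            (fun o => simulated H (public_key o) (Phi H (public_key o))))| <=
  2 * misguess_prob.
Proof.
move=> Phi01; have Z0 := card_Zq_gt0 G; set g := gexp (gen G).
have swap H (f f' : Z * bstate b * seq (Z * Z) * Z * (Z * Z) -> rat) :
    (forall o, 0 <= f o <= 1) -> (forall o, 0 <= f' o <= 1) ->
    (forall o, ~~ misguessed H o -> f o = f' o) ->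
    `|expect H session f - expect H session f'| <=
    expect H session (fun o => (misguessed H o)%:R).
  move=> f01 f'01 ff'; rewrite -expectB; apply: (le_trans (ler_norm_expect _ _ _)).
  apply/le_expect/always_true => o; case: (boolP (misguessed H o)) => [_|/ff'->].
    exact: dist_unit_interval.
  by rewrite subrr normr0.
rewrite -avgB -avgMl.
apply: (le_trans (ler_norm_avg _)); apply: le_avg => H; rewrite !expect_execute.
have sim01 X X' : 0 <= simulated H X (Phi H X') <= 1.
  have Phi_ge0 w : 0 <= Phi H X' w by case/andP: (Phi01 H X' w).
  have Phi_le1 w : Phi H X' w <= 1 by case/andP: (Phi01 H X' w).
  by rewrite expect_ge0 ?expect_le1//= => p; [apply: expect_le1|apply: expect_ge0].
pose key' (o : Z * bstate b * seq (Z * Z) * Z * (Z * Z)) := zadd o.1.2 (guess H o.1.1).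
pose real' (o : Z * bstate b * seq (Z * Z) * Z * (Z * Z)) :=
  Phi H (g (key' o)) (o.1.1.1.1, g o.1.2, o.2).
pose ideal' (o : Z * bstate b * seq (Z * Z) * Z * (Z * Z)) :=
  simulated H (g (key' o)) (Phi H (g (key' o))).
(* The sum of [v'] and the guess is uniform. In [real'] the token's message is the key times
   [g ^ - guess], as in [simulated]; [ideal'] depends on the session through its key only. Both are
   therefore [simulated] at a uniform key. *)
have hybrid : expect H session real' = expect H session ideal'.
  transitivity (avg (fun x => simulated H (g x) (Phi H (g x)))).
    rewrite -expect_avg expect_session; apply: eq_expect => p.
    rewrite [RHS](avg_reindex _ (zaddr_bij (guess H p))); apply: eq_avg => v'.
    by rewrite /real' /key' /= /g gexpD mulgK.
  rewrite expect_session -[LHS](expect_const Z0 H (logged [::] (commit b))).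
  apply: eq_expect => p; rewrite (avg_reindex _ (zaddr_bij (guess H p))).
  by apply: eq_avg => v'; rewrite /ideal' /key' /= expect_const.
(* Each of the two passages to a hybrid costs one [misguess_prob], hence the factor 2. *)
rewrite -(subrK (expect H session real') (expect H session (fun o => _))) -addrA.
apply: (le_trans (ler_normD _ _)); rewrite mulr_natl mulr2n; apply: lerD.
  apply: swap => [[[p v'] vr]|o|[[p v'] vr]]; rewrite ?Phi01//= /misguessed negbK.
  by move=> /eqP /= vr_guess; rewrite /real' /key' /= /g gexpD vr_guess.
rewrite hybrid; apply: swap => [o|[[p v'] vr]|[[p v'] vr]]; rewrite ?sim01//=.
rewrite /misguessed negbK => /eqP /= vr_guess.
by rewrite /ideal' /key' /= /g gexpD vr_guess.
Qed.

End HonestToken.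

(** * Polynomial bounds *)

Lemma leq_expn_base e m n : (m <= n)%N -> (m ^ e <= n ^ e)%N.
Proof. by case: e => // e mn; rewrite leq_exp2r. Qed.

Lemma poly_bound_pow c n : (n ^ c + c <= (n + 2) ^ c.+1)%N.
Proof.
have h1 : (n ^ c <= (n + 2) ^ c)%N by rewrite leq_expn_base// leq_addr.
have h2 : (c <= (n + 2) ^ c)%N.
  by rewrite (leq_trans (ltnW (ltn_expl c (leqnn 2))))// leq_expn_base// leq_addl.
by rewrite expnS; nia.
Qed.

(** A single power of [n + 2] is easier to add and multiply than [n ^ c + c]; the base is at least
    2, so constants are dominated even at [n = 0]. *)
Lemma poly_boundedP (p : nat -> nat) :
  poly_bounded p <-> exists c, forall n, (p n <= (n + 2) ^ c)%N.
Proof.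
split=> -[c pc].
  by exists c.+1 => n; apply: leq_trans (pc n) (poly_bound_pow c n).
(* For [n >= 2], [n + 2 <= n ^ 2] leads to the exponent [2 * c]; for [n <= 1] the power is at most
   [3 ^ c]. *)
exists (2 * c + 3 ^ c)%N => n; apply: (leq_trans (pc n)) => /=.
have [n2|n2] := leqP 2 n.
  apply: leq_trans (leq_addr _ _).
  apply: (@leq_trans (n ^ (2 * c))); last by rewrite leq_pexp2l; lia.
  by rewrite expnM leq_expn_base//; nia.
apply: leq_trans (leq_addl _ _); apply: leq_trans (leq_addl _ _).
by rewrite leq_expn_base//; lia.
Qed.

Lemma poly_boundedD p p' :
  poly_bounded p -> poly_bounded p' -> poly_bounded (fun n => p n + p' n)%N.
Proof.
move=> /poly_boundedP[c hc] /poly_boundedP[c' hc'].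
(* For positive [x] and [y], [x + y <= 2 * (x * y)]; the extra factor [n + 2] supplies the 2. *)
apply/poly_boundedP; exists (c + c').+1 => n.
have := hc n; have := hc' n; rewrite expnS expnD.
have: (0 < (n + 2) ^ c)%N by rewrite expn_gt0 addn2.
have: (0 < (n + 2) ^ c')%N by rewrite expn_gt0 addn2.
by move: ((n + 2) ^ c)%N ((n + 2) ^ c')%N => x y; nia.
Qed.

Lemma poly_boundedM p p' :
  poly_bounded p -> poly_bounded p' -> poly_bounded (fun n => p n * p' n)%N.
Proof.
move=> /poly_boundedP[c hc] /poly_boundedP[c' hc'].
by apply/poly_boundedP; exists (c + c')%N => n; rewrite expnD leq_mul.
Qed.

Lemma poly_bounded_const a : poly_bounded (fun=> a).
Proof. by exists a => n; rewrite leq_addl. Qed.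

(** With [k] the quotient of [L + 2] by [2 * m], [L + 2 <= 2 * m * (k + 1) <= 2 ^ (2 * m + k)]. The
    power [m] of this has exponent [2 * m ^ 2 + k * m], at most [L] once [k >= 2 * m + 2], which
    [L0] ensures. *)
Lemma exp_dominates e :
  exists L0, forall L, (L0 <= L)%N -> ((L + 2) ^ e < 2 ^ L)%N.
Proof.
pose m := e.+1; exists (2 * m * (2 * m + 2))%N => L hL.
set k := ((L + 2) %/ (2 * m))%N.
have m0 : (0 < 2 * m)%N by [].
have hk : (2 * m + 2 <= k)%N by rewrite leq_divRL// mulnC; lia.
have hk2 : (k * (2 * m) <= L + 2)%N by apply: leq_trunc_div.
have Lk : (L + 2 <= 2 ^ (2 * m) * 2 ^ k)%N.
  have := ltn_ceil (L + 2) m0; rewrite -/k => /ltnW /leq_trans; apply.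
  by rewrite mulnC leq_mul//; [exact/ltnW/ltn_expl|exact: ltn_expl].
have h1 : ((L + 2) ^ m <= 2 ^ (2 * m * m + k * m))%N.
  by rewrite -mulnDl [leqRHS]expnM [X in (_ <= X ^ _)%N]expnD leq_expn_base.
apply: (@leq_trans ((L + 2) ^ m)); first by rewrite ltn_exp2l; lia.
apply: (leq_trans h1); rewrite leq_exp2l//; nia.
Qed.

(** With [L] the logarithm of the order, [n <= L ^ b + b], so [p n * n ^ d] is polynomially bounded
    in [L] and falls below [2 ^ L], hence below the order. *)
Lemma negligible_over_order (Gs : nat -> prime_group) (p : nat -> nat) f :
  poly_related (fun n => trunc_log 2 (group_order (Gs n))) id ->
  poly_bounded p -> (forall n, f n <= (p n)%:R / #|Gs n|%:R) -> negligible f.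
Proof.
move=> [_ [b hb]] /poly_boundedP[a ha] fp d.
(* The exponent comes from [p n * n ^ d <= (n + 2) ^ (a + d)] and [n + 2 <= (L + 2) ^ (b + 2)]. *)
have [L0 hL0] := exp_dominates (b.+2 * (a + d)).
(* Beyond this value [L >= L0], since [L < L0] would give [n <= L0 ^ b + b]. *)
exists (L0 ^ b + b).+1 => n hn.
set L := trunc_log 2 (group_order (Gs n)) in hb.
have L0L : (L0 <= L)%N.
  rewrite leqNgt; apply: contraTN hn => LL0; rewrite -leqNgt.
  apply: (leq_trans (hb n)); rewrite leq_add2r leq_expn_base//; exact: ltnW.
have n0 : (0 < n)%N by lia.
have q0 : (0 < #|Gs n|)%N by rewrite ltnW// prime_gt1// prime_order.
have hq : (p n * n ^ d < #|Gs n|)%N.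
  apply: leq_trans (trunc_logP (leqnn 2) q0).
  apply: leq_trans (hL0 _ L0L); rewrite ltnS.
  apply: (@leq_trans ((n + 2) ^ (a + d))).
    by rewrite expnD leq_mul// leq_expn_base// leq_addr.
  rewrite expnM leq_expn_base// -/L.
  have := poly_bound_pow b L; have := hb n; rewrite [(_ ^ b.+2)%N]expnS /=.
  have: (L + 2 <= (L + 2) ^ b.+1)%N by rewrite -[leqLHS]expn1 leq_pexp2l// addn2.
  by rewrite -/L; move: ((L + 2) ^ b.+1)%N (L ^ b)%N => x y; nia.
apply: (le_lt_trans (fp n)).
rewrite ltr_pdivrMr ?ltr0n// mulrC ltr_pdivlMr ?exprn_gt0 ?ltr0n//.
by rewrite -natrX -natrM ltr_nat.
Qed.

(** * The simulator *)

Section Encodings.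

Variable G : prime_group.

Lemma tree_of_bitsK : cancel tree_of_bits bits_of_tree.
Proof. by elim=> //= -[] s ->. Qed.

Lemma bits_of_natK w k : nat_of_bits (bits_of_nat w k) = (k %% 2 ^ w)%N.
Proof.
elim: w k => [|w IH] k; first by rewrite modn1.
have -> : bits_of_nat w.+1 k = odd k :: bits_of_nat w (k %/ 2).
  rewrite /bits_of_nat /= expn0 divn1 (iotaDl 1 0) -map_comp; congr (_ :: _).
  by apply: eq_map => i /=; rewrite expnS divnMA.
rewrite /= IH expnS; set W := (2 ^ w)%N.
have W0 : (0 < W)%N by rewrite expn_gt0.
have ltW := ltn_pmod (k %/ 2) W0; have kW := divn_eq (k %/ 2) W.
have k2 : k = (odd k + 2 * (k %/ 2))%N by rewrite {1}(divn_eq k 2) modn2 mulnC addnC.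
rewrite [RHS](_ : _ =
  ((k %/ 2 %/ W) * (2 * W) + (odd k + 2 * (k %/ 2 %% W))) %% (2 * W))%N.
  rewrite modnMDl [RHS]modn_small//.
  by move: (k %/ 2 %% W)%N ltW => r; case: (odd k) => /=; lia.
congr (_ %% _)%N; move: (k %/ 2 %/ W)%N (k %/ 2 %% W)%N kW => a r kW; nia.
Qed.

Lemma tree_of_ZqK : cancel (@tree_of_Zq G) (@Zq_of_tree G).
Proof.
move=> z; rewrite /Zq_of_tree /tree_of_Zq tree_of_bitsK bits_of_natK modn_small.
  exact: natr_Zp.
apply: (@ltn_trans (group_order G)); last exact: trunc_log_ltn.
by rewrite -[X in (_ < X)%N](Zp_cast (group_order_gt1 G)) ltn_ord.
Qed.

Lemma tree_of_GK : cancel (@tree_of_G G) (@G_of_tree G).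
Proof.
move=> x; rewrite /G_of_tree /tree_of_G tree_of_bitsK.
case: pickP => [y /eqP/genc_inj//|/(_ x)]; by rewrite eqxx.
Qed.

End Encodings.

Section Queries.

Variable G : prime_group.

(** Each step makes at most one query. *)
Lemma run_queries T (s : config) : query_bound T (run G T s).
Proof.
elim: T s => //= T IH s; rewrite -add1n; apply: query_bound_bind => //.
by case: s => [[|[]]] //=.
Qed.

End Queries.

(** * Backward verification of programs: comparison, search of the log, instrumentation *)

Section Evaluation.

Variables (G : prime_group) (H : {ffun Zq G * Zq G -> Zq G}) (phi : Defs.mem -> rat).

(* From [s], every run halts within [t] steps, and [v] is the expected value of
   [phi] on the final memory.  The remaining commands are part of [s], so that
   programs are verified backwards. *)
Definition yields (t : nat) (s : config) (v : rat) : Prop :=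
  forall T, (t <= T)%N ->
    always_with H (run G T s) (fun s' => s'.1 = [::]) /\
    expect H (run G T s) (fun s' => phi s'.2) = v.

Lemma yields_nil m : yields 0 ([::], m) (phi m).
Proof. by elim=> //= T IH _; apply: IH. Qed.

Lemma yields_leq t t' s v : (t <= t')%N -> yields t s v -> yields t' s v.
Proof. by move=> tt' hs T t'T; apply: hs; apply: leq_trans t'T. Qed.

Lemma yields_step t s s' v :
  step G s = Ret s' -> yields t s' v -> yields t.+1 s v.
Proof. by move=> ss' hs' [|T]//= tT; rewrite ss'; apply: hs'. Qed.

Lemma yields_assign t i e k m v :
  yields t (k, upd m i (eval m e)) v -> yields t.+1 (Assign i e :: k, m) v.
Proof. exact: yields_step. Qed.

Lemma yields_seq t c1 c2 k m v :
  yields t ([:: c1, c2 & k], m) v -> yields t.+1 (Seq c1 c2 :: k, m) v.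
Proof. exact: yields_step. Qed.

Lemma yields_while t e c k m b v :
  truth (eval m e) = b ->
  yields t (if b then [:: c, While e c & k] else k, m) v ->
  yields t.+1 (While e c :: k, m) v.
Proof. by move=> <-; apply: yields_step. Qed.

Lemma yields_gmul t i e1 e2 k m v :
  yields t (k, upd m i (tree_of_G
    (G_of_tree G (eval m e1) * G_of_tree G (eval m e2))%g)) v ->
  yields t.+1 (GMul i e1 e2 :: k, m) v.
Proof. exact: yields_step. Qed.

Lemma yields_ginv t i e k m v :
  yields t (k, upd m i (tree_of_G (G_of_tree G (eval m e))^-1%g)) v ->
  yields t.+1 (GInv i e :: k, m) v.
Proof. exact: yields_step. Qed.

Lemma yields_gexp t i e1 e2 k m v :
  yields t (k, upd m i (tree_of_G
    (gexp (G_of_tree G (eval m e1)) (Zq_of_tree G (eval m e2))))) v ->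
  yields t.+1 (GExp i e1 e2 :: k, m) v.
Proof. exact: yields_step. Qed.

Lemma yields_if t e c1 c2 k m b v :
  truth (eval m e) = b -> yields t ((if b then c1 else c2) :: k, m) v ->
  yields t.+1 (If e c1 c2 :: k, m) v.
Proof. by move=> <-; apply: yields_step. Qed.

Lemma yields_hash t i e1 e2 k m v :
  yields t (k, upd m i (tree_of_Zq (H (Zq_of_tree G (eval m e1),
                                       Zq_of_tree G (eval m e2))))) v ->
  yields t.+1 (Hash i e1 e2 :: k, m) v.
Proof. by move=> hs [|T]//= tT; apply: hs. Qed.

Lemma yields_coin t i k m v :
  (forall b, yields t (k, upd m i (tree_of_bool b)) (v b)) ->
  yields t.+1 (Coin i :: k, m) (avg v).
Proof.
move=> hs [|T]//= tT; split=> [b|]; first by have [] := hs b T tT.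
by apply: eq_avg => b; have [] := hs b T tT.
Qed.

Lemma yields_sample t i k m v :
  (forall z : Zq G, yields t (k, upd m i (tree_of_Zq z)) (v z)) ->
  yields t.+1 (Sample i :: k, m) (avg v).
Proof.
move=> hs [|T]//= tT; split=> [z|]; first by have [] := hs z T tT.
by apply: eq_avg => z; have [] := hs z T tT.
Qed.

(** The flag [e] can only be cleared; [Assign e (Var e)] serves as a no-op. *)
Definition compare_bit p q e : cmd :=
  If (Var q)
    (If (Hd (Var p))
      (If (Hd (Var q)) (Assign e (Var e)) (Assign e Defs.Nil))
      (If (Hd (Var q)) (Assign e Defs.Nil) (Assign e (Var e))))
    (Assign e Defs.Nil).

Lemma yields_compare_bit (p q e : nat) b s1 s2 k m t v :
  m p = tree_of_bits (b :: s1) -> m q = tree_of_bits s2 ->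
  (forall m' : Defs.mem, (forall j, j != e -> m' j = m j) ->
     truth (m' e) = [&& truth (m e), (0 < size s2)%N & b == head false s2] ->
     yields t (k, m') v) ->
  yields (4 + t) (compare_bit p q e :: k, m) v.
Proof.
move=> mp mq hs.
have eq_else T j : j != e -> upd m e T j = m j by rewrite /upd => /negbTE->.
have eq_at T : upd m e T e = T by rewrite /upd eqxx.
case: s2 mq hs => [|b' s2] mq hs.
  apply: (@yields_leq (2 + t)); first by rewrite leq_add2r.
  apply: (yields_if (b := false)); first by rewrite /= mq.
  apply: yields_assign; apply: hs => [j|]; first exact: eq_else.
  by rewrite eq_at /= andbF.
apply: (yields_if (b := true)); first by rewrite /= mq.
apply: (yields_if (b := b)); first by rewrite /= mp; case: (b).
case: b mp hs => mp hs; apply: (yields_if (b := b'));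
  rewrite ?/= ?mq //=; try by case: (b').
all: case: b' mq hs => mq hs /=; apply: yields_assign; apply: hs => [j|];
  try exact: eq_else.
all: by rewrite eq_at ?andbT ?andbF.
Qed.

(** The loop follows the list in [p]; a shorter list in [q] clears the flag within the loop, a
    longer one after it. *)
Definition compare p q e : cmd :=
  Seq (While (Var p) (Seq (compare_bit p q e)
         (Seq (Assign p (Tl (Var p))) (Assign q (Tl (Var q))))))
      (If (Var q) (Assign e Defs.Nil) (Assign e (Var e))).

(** Nine steps per bit: the loop test, two [Seq], four for [compare_bit] and two assignments. The
    other four are the outer [Seq], the last loop test and the final conditional with its
    assignment. *)
Lemma yields_compare (p q e : nat) s1 s2 k (m : Defs.mem) t v :
  [&& p != q, p != e & q != e] ->
  m p = tree_of_bits s1 -> m q = tree_of_bits s2 ->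
  (forall m' : Defs.mem, (forall j, j != p -> j != q -> j != e -> m' j = m j) ->
     truth (m' e) = truth (m e) && (s1 == s2) -> yields t (k, m') v) ->
  yields (9 * size s1 + 4 + t) (compare p q e :: k, m) v.
Proof.
move=> /and3P[pq pe qe] mp mq hs; rewrite addnS addSn; apply: yields_seq.
elim: s1 s2 m mp mq hs => [|b s1 IH] s2 m mp mq hs.
  apply: (yields_while (b := false)); first by rewrite /= mp.
  apply: (yields_if (b := (0 < size s2)%N)); first by rewrite /= mq; case: (s2).
  case: s2 mq hs => [|b' s2] mq hs /=; apply: yields_assign; apply: hs => [j jp jq je|].
  - by rewrite /upd (negbTE je).
  - by rewrite /upd !eqxx andbT.
  - by rewrite /upd (negbTE je).
  - by rewrite /upd eqxx andbF.
apply: (@yields_leq (4 + (9 * size s1 + 3 + t).+3).+2); first by rewrite /=; lia.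
apply: (yields_while (b := true)); first by rewrite /= mp.
apply: yields_seq; apply: (yields_compare_bit mp mq) => m1 m1_else m1e.
apply: yields_seq; do 2 apply: yields_assign.
have tl_s2 : (if tree_of_bits s2 is Node _ u then u else Leaf) = tree_of_bits (behead s2).
  by case: (s2).
apply: (IH (behead s2)) => [||m' m'_else m'e].
- by rewrite /upd (negbTE pq) eqxx /= m1_else// mp.
- by rewrite /upd eqxx /= eq_sym (negbTE pq) m1_else// mq tl_s2.
apply: hs => [j jp jq je|].
  by rewrite m'_else// /upd (negbTE jp) (negbTE jq) m1_else.
rewrite m'e /upd eq_sym (negbTE qe) eq_sym (negbTE pe) m1e -!andbA; congr (_ && _).
by case: (s2).
Qed.

Fixpoint tree_log (t : tree) : seq (Zq G * Zq G) :=
  if t is Node h t' then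
    (Zq_of_tree G (if h is Node a _ then a else Leaf),
     Zq_of_tree G (if h is Node _ b then b else Leaf)) :: tree_log t'
  else [::].

Variable K : nat.

(* Registers from [K] on are not used by the simulated browser: [K + 0] holds the
   public key, [K + 1] the generator, [K + 2] the commitment, [K + 3] the log
   and [K + 4] the extracted value. *)
Definition search : cmd :=
  While (Var (K + 3))
    (Seq (Hash (K + 8) (Hd (Hd (Var (K + 3)))) (Tl (Hd (Var (K + 3)))))
    (Seq (GExp (K + 5) (Var (K + 1)) (Var (K + 8)))
    (Seq (GExp (K + 6) (Var (K + 1)) (Var (K + 2)))
    (Seq (Assign (K + 7) (Pair Defs.Nil Defs.Nil))
    (Seq (compare (K + 5) (K + 6) (K + 7))
    (Seq (If (Var (K + 7)) (Assign (K + 4) (Hd (Hd (Var (K + 3)))))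
                           (Assign (K + 7) (Var (K + 7))))
         (Assign (K + 3) (Tl (Var (K + 3)))))))))).

(** The commitment register need not hold a canonical code, so the loop compares [g ^ H x] with
    [g ^ c], whose codes are canonical and determine the exponents. A comparison takes nine steps
    per bit of a code of at most [B] bits; 19 covers the other steps of an iteration. *)
Lemma yields_search (B : nat) k (m : Defs.mem) t v :
  (forall x : G, size (genc x) <= B)%N -> m (K + 1)%N = tree_of_G (gen G) ->
  (forall m' : Defs.mem,
     (forall j, (j < K + 3)%N -> m' j = m j) ->
     Zq_of_tree G (m' (K + 4)%N) =
       extract H (Zq_of_tree G (m (K + 2)%N)) (Zq_of_tree G (m (K + 4)%N))
         (tree_log (m (K + 3)%N)) ->
     yields t (k, m') v) ->
  yields (size (tree_log (m (K + 3)%N)) * (9 * B + 19) + 1 + t)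
         (search :: k, m) v.
Proof.
move=> hB mg hs; have [l ml] : exists l, m (K + 3)%N = l by eexists.
rewrite ml; elim: l m mg hs ml => [|h _ l IH] m mg hs ml.
  apply: (yields_while (b := false)); first by rewrite /= ml.
  by apply: hs => //; rewrite ml.
pose x := (Zq_of_tree G (if h is Node a _ then a else Leaf),
           Zq_of_tree G (if h is Node _ b then b else Leaf)).
pose c := Zq_of_tree G (m (K + 2)%N).
pose s1 := genc (gexp (gen G) (H x)); pose s2 := genc (gexp (gen G) c).
apply: (@yields_leq ((9 * size s1 + 4 +
    (size (tree_log l) * (9 * B + 19) + 1 + t).+4).+4.+4.+2)).
  by have := hB (gexp (gen G) (H x)); rewrite -/s1 /=; nia.
apply: (yields_while (b := true)); first by rewrite /= ml.
apply/yields_seq/yields_hash/yields_seq/yields_gexp/yields_seq/yields_gexp.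
apply/yields_seq/yields_assign/yields_seq.
have upd_at (m0 : Defs.mem) i j T :
    upd m0 (K + i)%N T (K + j)%N = if j == i then T else m0 (K + j)%N.
  by rewrite /upd eqn_add2l.
have upd_below (m0 : Defs.mem) i j T : (j < K + i)%N -> upd m0 (K + i)%N T j = m0 j.
  by rewrite /upd => /ltn_eqF->.
apply: (yields_compare (s1 := s1) (s2 := s2)) => [||| m1 m1_else m1e].
- by rewrite !eqn_add2l.
- by rewrite /= !upd_at /= ?upd_at /= ml mg !tree_of_ZqK !tree_of_GK.
- by rewrite /= !upd_at /= ?upd_at /= mg !tree_of_GK.
have m1E j : j != 5%N -> j != 6%N -> j != 7%N -> m1 (K + j)%N =
    if j == 8%N then tree_of_Zq (H x) else m (K + j)%N.
  move=> j5 j6 j7; rewrite m1_else ?eqn_add2l// !upd_at (negbTE j5) (negbTE j6).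
  by rewrite (negbTE j7) /= ml.
have eq_s : (s1 == s2) = (H x == c).
  apply/eqP/eqP => [/genc_inj|]; first exact/bij_inj/gexp_gen_bij.
  by rewrite /s1 => ->.
move: m1e; rewrite upd_at eqxx /= eq_s => m1e.
have lt_K j : (j < K + 3)%N -> forall i, (3 <= i)%N -> (j < K + i)%N.
  by move=> jK i i3; apply: (leq_trans jK); rewrite leq_add2l.
have m1_below j : (j < K + 3)%N -> m1 j = m j.
  by move=> /lt_K ltK; rewrite m1_else ?neq_ltn ?ltK// !upd_below// ?ltK.
apply: yields_seq; apply: (yields_if (b := H x == c)) => //.
pose m2 : Defs.mem := if H x == c then
    upd m1 (K + 4)%N (if h is Node a _ then a else Leaf)
  else upd m1 (K + 7)%N (m1 (K + 7)%N).
apply: (@yields_step _ _ ([:: Assign (K + 3) (Tl (Var (K + 3))), search & k], m2)).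
  by rewrite /m2; case: ifP => _ //; rewrite /step /= m1E// ml; case: (h).
have m2E j : j != 4%N -> j != 7%N -> m2 (K + j)%N = m1 (K + j)%N.
  by move=> j4 j7; rewrite /m2; case: ifP; rewrite upd_at ?(negbTE j4) ?(negbTE j7).
have m2_below j : (j < K + 3)%N -> m2 j = m j.
  move=> jK; have ltK := lt_K _ jK.
  by rewrite /m2; case: ifP; rewrite upd_below ?ltK// m1_below.
apply: yields_assign; apply: IH => [|m' m'_below m'w|].
- by rewrite upd_at m2_below ?leq_add2l ?ltn_add2l.
- apply: hs => [j jK|]; first by rewrite m'_below// upd_below// m2_below.
  rewrite m'w !upd_at /= m2_below ?ltn_add2l// -/c ml (m2E 3%N)// (m1E 3%N)//= ml /= -/x.
  congr (extract _ _ _ _); rewrite /m2; case: ifP; rewrite upd_at//= m1E//.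
- by rewrite upd_at /= m2E// m1E//= ml.
Qed.

Definition below (m m' : Defs.mem) := forall i, (i < K)%N -> m' i = m i.

Fixpoint expr_regs (e : expr) : nat :=
  match e with
  | Var i => i.+1
  | Defs.Nil => 0
  | Pair e1 e2 => maxn (expr_regs e1) (expr_regs e2)
  | Hd e1 | Tl e1 => expr_regs e1
  end.

Fixpoint cmd_regs (c : cmd) : nat :=
  match c with
  | Assign i e | GInv i e => maxn i.+1 (expr_regs e)
  | Seq c1 c2 => maxn (cmd_regs c1) (cmd_regs c2)
  | If e c1 c2 => maxn (expr_regs e) (maxn (cmd_regs c1) (cmd_regs c2))
  | While e c1 => maxn (expr_regs e) (cmd_regs c1)
  | Coin i | Sample i => i.+1
  | Hash i e1 e2 | GMul i e1 e2 | GExp i e1 e2 =>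
      maxn i.+1 (maxn (expr_regs e1) (expr_regs e2))
  end.

Lemma eval_below m m' e : below m m' -> (expr_regs e <= K)%N -> eval m' e = eval m e.
Proof.
move=> mm'; elim: e => [i|//|e1 IH1 e2 IH2|e IH|e IH] /=; first exact: mm'.
- by rewrite geq_max => /andP[/IH1-> /IH2->].
- by move/IH->.
- by move/IH->.
Qed.

(** The operands are recorded before the query, whose result may overwrite registers that they
    mention. *)
Fixpoint instrument (c : cmd) : cmd :=
  match c with
  | Seq c1 c2 => Seq (instrument c1) (instrument c2)
  | If e c1 c2 => If e (instrument c1) (instrument c2)
  | While e c1 => While e (instrument c1)
  | Hash i e1 e2 =>
      Seq (Assign (K + 3) (Pair (Pair e1 e2) (Var (K + 3)))) (Hash i e1 e2)
  | c => c
  end.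

(** [m] is the memory of the original program and [m'] that of the instrumented one; [m0] gives the
    private registers, which are preserved apart from the log. *)
Definition mirrors (m0 m m' : Defs.mem) : Prop :=
  below m m' /\ forall i, (K <= i)%N -> i != (K + 3)%N -> m' i = m0 i.

Lemma mirrors_upd m0 m m' i T :
  (i < K)%N -> mirrors m0 m m' -> mirrors m0 (upd m i T) (upd m' i T).
Proof.
move=> iK [mm' m0m']; split=> [j jK|j Kj j3].
  by rewrite /upd mm'.
by rewrite /upd gtn_eqF ?m0m'// (leq_trans iK).
Qed.

(** Induction on the original steps along [mirrors]. A query becomes [Seq], [Assign] and [Hash],
    hence three steps for one; the continuation [k] starts once the original program has halted. *)
Lemma yields_instrument T0 cs m m' m0 l k t F :
  always_with H (logged l (run G T0 (cs, m))) (fun p =>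
    p.1.1 = [::] /\ forall m1, mirrors m0 p.1.2 m1 -> tree_log (m1 (K + 3)%N) = p.2 ->
      yields t (k, m1) (F p.1.2 p.2)) ->
  all (fun c => cmd_regs c <= K)%N cs ->
  mirrors m0 m m' -> tree_log (m' (K + 3)%N) = l ->
  yields (3 * T0 + t) (map instrument cs ++ k, m')
    (expect H (logged l (run G T0 (cs, m))) (fun p => F p.1.2 p.2)).
Proof.
elim: T0 cs m m' l => [|T0 IH] cs m m' l hrun csK mm' m'l.
  by case: hrun => /= cs0 hF; move: hF csK; rewrite cs0 => hF _; apply: hF.
have log_upd i T : (i < K)%N -> tree_log (upd m' i T (K + 3)%N) = l.
  by move=> iK; rewrite /upd gtn_eqF// (leq_trans iK)// leq_addr.
apply: (@yields_leq (3 * T0 + t).+3); first by rewrite mulnS.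
(* Every command other than [Hash] takes only one of its three steps. *)
have slack s v : yields (3 * T0 + t).+1 s v -> yields (3 * T0 + t).+3 s v.
  by apply: yields_leq; rewrite ltnW.
case: cs hrun csK => [|c cs] hrun csK.
  by apply: (@yields_leq (3 * T0 + t)); [lia|exact: (IH [::])].
case: mm' => mm' m0m'; have mm := conj mm' m0m'.
case: c hrun csK => /=.
- move=> i e hrun; rewrite geq_max => /andP[/andP[iK eK] csK].
  apply/slack/yields_assign; rewrite (eval_below mm' eK).
  by apply: IH => //; [apply: mirrors_upd|apply: log_upd].
- move=> c1 c2 hrun; rewrite geq_max => /andP[/andP[c1K c2K] csK].
  apply/slack/yields_seq; apply: (IH [:: c1, c2 & cs]) => //=.
  by rewrite c1K c2K.
- move=> e c1 c2 hrun; rewrite !geq_max => /andP[/and3P[eK c1K c2K] csK].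
  apply/slack/yields_if; first by [].
  rewrite (eval_below mm' eK); have := IH ((if truth (eval m e) then c1 else c2) :: cs).
  by case: ifP hrun => _ hrun /(_ m m' l hrun); apply; rewrite //= ?c1K ?c2K.
- move=> e c1 hrun; rewrite geq_max => /andP[/andP[eK c1K] csK].
  apply/slack/yields_while; first by [].
  rewrite (eval_below mm' eK).
  have := IH (if truth (eval m e) then [:: c1, While e c1 & cs] else cs).
  by case: ifP hrun => _ hrun /(_ m m' l hrun); apply; rewrite //= ?c1K ?geq_max ?eK ?c1K.
- move=> i hrun /andP[iK csK]; apply/slack/yields_coin => b.
  by apply: IH => //; [apply: mirrors_upd|apply: log_upd].
- move=> i hrun /andP[iK csK]; apply/slack/yields_sample => z.
  by apply: IH => //; [apply: mirrors_upd|apply: log_upd].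
- move=> i e1 e2 hrun; rewrite !geq_max => /andP[/and3P[iK e1K e2K] csK].
  apply/yields_seq/yields_assign/yields_hash.
  set m1 := upd m' _ _.
  have mm1 : below m m1.
    by move=> j jK; rewrite /m1 /upd ltn_eqF ?mm'// (leq_trans jK)// leq_addr.
  rewrite !(eval_below mm1)//; apply: IH => //.
    apply: mirrors_upd => //; split=> // j Kj j3.
    by rewrite /m1 /upd (negbTE j3) m0m'.
  rewrite /upd gtn_eqF; last by rewrite (leq_trans iK)// leq_addr.
  by rewrite /m1 /upd eqxx /= m'l !(eval_below mm').
- move=> i e1 e2 hrun; rewrite !geq_max => /andP[/and3P[iK e1K e2K] csK].
  apply/slack/yields_gmul; rewrite !(eval_below mm')//.
  by apply: IH => //; [apply: mirrors_upd|apply: log_upd].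
- move=> i e hrun; rewrite geq_max => /andP[/andP[iK eK] csK].
  apply/slack/yields_ginv; rewrite (eval_below mm' eK).
  by apply: IH => //; [apply: mirrors_upd|apply: log_upd].
- move=> i e1 e2 hrun; rewrite !geq_max => /andP[/and3P[iK e1K e2K] csK].
  apply/slack/yields_gexp; rewrite !(eval_below mm')//.
  by apply: IH => //; [apply: mirrors_upd|apply: log_upd].
Qed.

End Evaluation.

(** * The simulator of a given browser *)

Section Simulator.

Variable B : browser_machine.

(** The lower bound 4 keeps clear of registers 0 to 3, which hold the inputs and the output view. *)
Definition fresh : nat :=
  maxn 4 (maxn (cmd_regs (commit_code B)) (cmd_regs (reveal_code B))).

Local Notation K := fresh.

(** The key and the generator are saved before the browser can overwrite them, and register 3 is
    cleared to restore the browser's own initial memory. At the end the revealed pair leaves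
    registers 0 and 1 before the commitment and the token's message are put there. *)
Definition simulator_code : cmd :=
  Seq (Assign (K + 0) (Var 3))
  (Seq (Assign (K + 1) (Var 2))
  (Seq (Assign 3 Defs.Nil)
  (Seq (instrument K (commit_code B))
  (Seq (Assign (K + 2) (Var 0))
  (Seq (Assign (K + 4) Defs.Nil)
  (Seq (search K)
  (Seq (GExp (K + 5) (Var (K + 1)) (Var (K + 4)))
  (Seq (GInv (K + 5) (Var (K + 5)))
  (Seq (GMul (K + 5) (Var (K + 0)) (Var (K + 5)))
  (Seq (Assign 0 (Var (K + 5)))
  (Seq (instrument K (reveal_code B))
  (Seq (Assign 2 (Var 0))
  (Seq (Assign 3 (Var 1))
  (Seq (Assign 0 (Var (K + 2)))
       (Assign 1 (Var (K + 5))))))))))))))))).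

(** Two instrumented phases take three times the browser's clock each, the search at most
    [9 * size_bound n + 19] steps per logged query; 40 covers the rest. *)
Definition simulator (size_bound : nat -> nat) : machine := {|
  code := simulator_code;
  clock n := bclock B n * (9 * size_bound n + 25) + 40
|}.

Lemma fresh_ge4 : (4 <= K)%N.
Proof. exact: leq_maxl. Qed.

Lemma upd_fresh (m : Defs.mem) i j T :
  upd m (K + i)%N T (K + j)%N = if j == i then T else m (K + j)%N.
Proof. by rewrite /upd eqn_add2l. Qed.

Lemma upd_fresh_low (m : Defs.mem) i j T : (j < K)%N -> upd m (K + i)%N T j = m j.
Proof. by move=> jK; rewrite /upd ltn_eqF// (leq_trans jK)// leq_addr. Qed.

Lemma upd_low_fresh (m : Defs.mem) i j T :
  (i < K)%N -> upd m i T (K + j)%N = m (K + j)%N.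
Proof. by move=> iK; rewrite /upd gtn_eqF// (leq_trans iK)// leq_addr. Qed.

Lemma simulator_yields (G : prime_group) (n b : nat) (H : {ffun Zq G * Zq G -> Zq G})
    (X : G) (f : view G -> rat) :
  (forall x : G, size (genc x) <= b)%N ->
  halts G (bclock B n) (commit_code B) (start G n [::]) ->
  (forall V : G,
     always (bind (exec G (bclock B n) (commit_code B) (start G n [::])) (fun m =>
             run G (bclock B n) ([:: reveal_code B], upd m 0 (tree_of_G V))))
            (fun s => s.1 = [::])) ->
  yields H (fun m => f (view_of_mem G m)) (bclock B n * (9 * b + 25) + 40)
    ([:: simulator_code], start G n [:: tree_of_G X])
    (simulated (browser_of G n B) H X f).
Proof.
set T := bclock B n => hb hcommit hreveal; set st := start G n _.
have lowK i : (i < 4)%N -> (i < K)%N by move=> i4; apply: leq_trans fresh_ge4.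
have commitK : all (fun c => cmd_regs c <= K)%N [:: commit_code B].
  by rewrite /= andbT /fresh !leq_max leqnn orbT.
have revealK : all (fun c => cmd_regs c <= K)%N [:: reveal_code B].
  by rewrite /= andbT /fresh !leq_max leqnn !orbT.
pose e (m : Defs.mem) l := extract H (Zq_of_tree G (m 0%N)) (Zq_of_tree G Leaf) l.
pose V m l : G := (X * (gexp (gen G) (e m l))^-1)%g.
pose F (m : Defs.mem) l : rat :=
  expect H (run G T ([:: reveal_code B], upd m 0 (tree_of_G (V m l)))) (fun s =>
    f (Zq_of_tree G (m 0%N), V m l, (Zq_of_tree G (s.2 0%N), Zq_of_tree G (s.2 1%N)))).
have -> : simulated (browser_of G n B) H X f =
    expect H (logged [::] (run G T ([:: commit_code B], start G n [::])))
      (fun p => F p.1.2 p.2).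
  rewrite /simulated /= /exec !expect_logged_bind.
  apply: eq_expect => -[[cs m] l] /=; rewrite !expect_bind.
  by apply: eq_expect => -[cs' m'].
apply: (@yields_leq _ _ _ ((3 * T + (T * (9 * b + 19) + 1 +
  (3 * T + 7).+4.+4.+1).+4.+1).+4.+3)); first by lia.
do 3 (apply/yields_seq/yields_assign); apply: yields_seq.
set m0 := upd _ 3 _.
have m0_low : below K (start G n [::]) m0.
  move=> i iK; rewrite /m0 /upd; case: ifP => [/eqP->//|i3].
  rewrite !ltn_eqF ?(leq_trans iK) ?leq_addr//.
  by move: i i3 {iK} => [|[|[|[|i]]]] //= _; rewrite /st /start /= ?nth_nil.
have m0X : m0 (K + 0)%N = tree_of_G X.
  by rewrite /m0 upd_low_fresh ?lowK// upd_fresh /= upd_fresh.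
have m0g : m0 (K + 1)%N = tree_of_G (gen G).
  by rewrite /m0 upd_low_fresh ?lowK// upd_fresh /= upd_fresh_low// lowK.
(* Only registers 0 to 3 are set initially, so the log starts empty. *)
have m0log : tree_log G (m0 (K + 3)%N) = [::].
  rewrite /m0 upd_low_fresh ?lowK// !upd_fresh /= /st /start nth_default//=.
  by have := fresh_ge4; rewrite addn3; lia.
apply: (yields_instrument (cs := [:: commit_code B]) (m0 := m0)) => //.
have halts_commit := hcommit H.
(* The group element given to the second phase depends on the run of the first, so halting is needed
   for all of them at once, inside the run. *)
have halts_reveal : always_with H (run G T ([:: commit_code B], start G n [::]))
    (fun s => forall V' : G, always_with H
      (run G T ([:: reveal_code B], upd s.2 0 (tree_of_G V'))) (fun s' => s'.1 = [::])).
  apply: (always_forall (P := fun (V' : G) s => always_with H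
      (run G T ([:: reveal_code B], upd s.2 0 (tree_of_G V')))
      (fun s' => s'.1 = [::]))) => V'.
  have /always_bind/always_bind := hreveal V' H.
  by apply: always_sub => -[].
have := always_and (always_logged [::] (always_and halts_commit halts_reveal))
  (logged_size H [::] (@run_queries G T ([:: commit_code B], start G n [::]))).
apply: always_sub => -[[cs m] l] /= [[-> halts_m]]; rewrite addn0 => lT.
split=> // m1 [m1_low m1_high] m1l.
apply/yields_seq/yields_assign/yields_seq/yields_assign/yields_seq.
set m2 := upd _ (K + 4) _.
have m2K j : j != 2%N -> j != 4%N -> m2 (K + j)%N = m1 (K + j)%N.
  by move=> j2 j4; rewrite /m2 !upd_fresh (negbTE j2) (negbTE j4).
have m1K j : j != 3%N -> m1 (K + j)%N = m0 (K + j)%N.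
  by move=> j3; rewrite m1_high ?leq_addr// eqn_add2l.
have m22 : m2 (K + 2)%N = m 0%N by rewrite /m2 !upd_fresh /= m1_low ?lowK.
have m24 : m2 (K + 4)%N = Leaf by rewrite /m2 upd_fresh.
have m2l : tree_log G (m2 (K + 3)%N) = l by rewrite m2K.
(* The first phase logs at most [T] queries. *)
apply: (@yields_leq _ _ _ (size (tree_log G (m2 (K + 3)%N)) * (9 * b + 19) + 1 +
    (3 * T + 7).+4.+4.+1)); first by rewrite m2l !leq_add2r leq_mul2r lT orbT.
apply: (yields_search hb) => [|m3 m3_low]; first by rewrite m2K// m1K.
rewrite m22 m24 m2l -/(e m l) => m3w.
apply/yields_seq/yields_gexp/yields_seq/yields_ginv/yields_seq/yields_gmul.
apply/yields_seq/yields_assign/yields_seq.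
rewrite /= !upd_fresh /= ?upd_fresh /= !tree_of_GK m3w.
rewrite !m3_low ?ltn_add2l// !m2K// !m1K// m0g m0X !tree_of_GK -/(V m l).
set m4 := upd _ 0 _.
have m4_low : below K (upd m 0 (tree_of_G (V m l))) m4.
  move=> i iK; rewrite /m4 /upd; case: ifP => // i0.
  rewrite !ltn_eqF ?(leq_trans iK) ?leq_addr// m3_low ?(leq_trans iK) ?leq_addr//.
  by rewrite /m2 !upd_fresh_low ?m1_low.
have m4c : m4 (K + 2)%N = m 0%N.
  by rewrite /m4 upd_low_fresh ?lowK// !upd_fresh /= m3_low ?ltn_add2l.
have m4V : m4 (K + 5)%N = tree_of_G (V m l).
  by rewrite /m4 upd_low_fresh ?lowK// upd_fresh.
rewrite /F -(expect_logged H (tree_log G (m4 (K + 3)%N))).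
apply: (yields_instrument (cs := [:: reveal_code B]) (m0 := m4)
  (F := fun m' _ => f (Zq_of_tree G (m 0%N), V m l,
                       (Zq_of_tree G (m' 0%N), Zq_of_tree G (m' 1%N))))) => //.
apply: always_sub (always_logged _ (halts_m (V m l))) => -[[cs' m'] l'] /= ->.
split=> // m5 [m5_low m5_high] _.
apply/yields_seq/yields_assign/yields_seq/yields_assign/yields_seq.
apply/yields_assign/yields_assign.
set m6 := upd _ 1 _.
have <- : view_of_mem G m6 = (Zq_of_tree G (m 0%N), V m l,
    (Zq_of_tree G (m' 0%N), Zq_of_tree G (m' 1%N))).
  have m5K j : j != 3%N -> m5 (K + j)%N = m4 (K + j)%N.
    by move=> j3; rewrite m5_high ?leq_addr// eqn_add2l.
  rewrite /view_of_mem /m6 /= !upd_low_fresh ?lowK//.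
  rewrite !m5K// m4c m4V tree_of_GK.
  by rewrite /upd /= !m5_low ?lowK.
exact: yields_nil.
Qed.

Lemma simulateE (G : prime_group) (n : nat) (size_bound : nat -> nat)
    (H : {ffun Zq G * Zq G -> Zq G}) (X : G) (f : view G -> rat) :
  yields H (fun m => f (view_of_mem G m)) (clock (simulator size_bound) n)
    ([:: simulator_code], start G n [:: tree_of_G X])
    (simulated (browser_of G n B) H X f) ->
  expect H (simulate n (simulator size_bound) X) f =
  simulated (browser_of G n B) H X f.
Proof.
move=> /(_ _ (leqnn _)) [_ <-]; rewrite /simulate /run_machine /exec !expect_bind.
by apply: eq_expect => -[].
Qed.

End Simulator.

(** * The three claims *)

Lemma exec_queries (G : prime_group) T c m : query_bound T (exec G T c m).
Proof.
rewrite -[X in query_bound X _]addn0; apply: query_bound_bind => [|[s m']//].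
exact: run_queries.
Qed.

Theorem theorem2 (Gs : nat -> prime_group)
    (hsec : poly_related (fun n => trunc_log 2 (group_order (Gs n))) id)
    (henc : exists c : nat, forall (n : nat) (x : Gs n),
              (size (genc x) <= n ^ c + c)%N) :
  (forall T : machine, efficient_token Gs T ->
     negligible (fun n =>
       stat_dist
         (fun X : Gs n =>
            prob (execute (honest_browser (Gs n)) (token_of (Gs n) n T))
                 (fun o => public_key o == X))
         (uniform (Gs n))))
  /\
  (forall B : browser_machine, efficient_browser Gs B ->
     (forall n, never_fails (browser_of (Gs n) n B)) ->
     negligible (fun n =>
       stat_dist
         (fun x : Zq (Gs n) =>
            prob (execute (browser_of (Gs n) n B) (honest_token (Gs n)))
                 (fun o => private_key o == Some x))
         (uniform (Zq (Gs n)))))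
  /\
  (forall B : browser_machine, efficient_browser Gs B ->
     (forall n, never_fails (browser_of (Gs n) n B)) ->
     exists S : machine, efficient_simulator Gs S /\
       forall D : machine, efficient_distinguisher Gs D ->
         negligible (fun n =>
           `| prob (real_game Gs B D n) id - prob (ideal_game Gs B S D n) id |)).
Proof.
have browser_bound (B : browser_machine) : efficient_browser Gs B ->
    (forall n, never_fails (browser_of (Gs n) n B)) ->
    exists2 p, poly_bounded p & forall n,
      misguess_prob (browser_of (Gs n) n B) <= (p n)%:R / #|Gs n|%:R.
  move=> [B_poly _] B_ok; exists (fun n => (bclock B n + bclock B n).+1 ^ 2)%N.
    have Bp1 : poly_bounded (fun n => (bclock B n + bclock B n).+1).
      have := poly_boundedD (poly_boundedD B_poly B_poly) (poly_bounded_const 1).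
      by case=> a ha; exists a => n; rewrite -addn1.
    exact: (poly_boundedM Bp1 Bp1).
  move=> n; apply: misguess_bound => // [|m V].
    by rewrite -[bclock B n]addn0; apply: query_bound_bind => //; apply: exec_queries.
  by rewrite -[bclock B n]addn0; apply: query_bound_bind => //; apply: exec_queries.
split=> [T [T_poly _]|].
  apply: (negligible_over_order hsec T_poly) => n.
  apply: honest_browser_bias => c.
  by rewrite -[clock T n]addn0; apply: query_bound_bind => //; apply: exec_queries.
split=> B B_eff B_ok; have [p p_poly hp] := browser_bound B B_eff B_ok.
  apply: (negligible_over_order hsec p_poly) => n.
  exact: le_trans (honest_token_bias (B_ok n)) (hp n).
have [c hc] := henc; have [B_poly B_halts] := B_eff.
pose S := simulator B (fun n => n ^ c + c)%N; exists S.
have yields_S n X H f := simulator_yields H X f (hc n)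
  (B_halts n).1 (B_halts n).2.
split.
  (* Halting is the first half of [yields], obtained here with a constant function. *)
  split=> [|n X H]; last exact: (yields_S n X H (fun=> 0) _ (leqnn _)).1.
  have c_poly : poly_bounded (fun n => n ^ c + c)%N by exists c.
  apply: poly_boundedD (poly_bounded_const _); apply: poly_boundedM B_poly _.
  apply: poly_boundedD (poly_bounded_const _).
  exact: poly_boundedM (poly_bounded_const _) c_poly.
move=> D _.
apply: (negligible_over_order hsec (poly_boundedM (poly_bounded_const 2) p_poly)) => n.
(* The acceptance probability is taken under the same fixed oracle as the execution, before
   averaging over [H]. *)
pose Phi H (X : Gs n) w := expect H (distinguish n D X w) (fun b => (id b)%:R).
have Phi01 H X w : 0 <= Phi H X w <= 1.
  by rewrite expect_ge0 ?expect_le1 ?card_Zq_gt0// => -[].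
have real_eq : prob (real_game Gs B D n) id =
    avg (fun H => expect H (execute (browser_of (Gs n) n B) (honest_token (Gs n)))
      (fun o => Phi H (public_key o) (transcript o))).
  by rewrite probE; apply: eq_avg => H; apply: expect_bind.
have ideal_eq : prob (ideal_game Gs B S D n) id =
    avg (fun H => expect H (execute (browser_of (Gs n) n B) (honest_token (Gs n)))
      (fun o => simulated (browser_of (Gs n) n B) H (public_key o)
                  (Phi H (public_key o)))).
  rewrite probE; apply: eq_avg => H; rewrite expect_bind; apply: eq_expect => o.
  rewrite expect_bind; apply: simulateE.
  exact: (yields_S n (public_key o) H (Phi H (public_key o))).
rewrite real_eq ideal_eq.
apply: (le_trans (simulation_error (browser_of (Gs n) n B) Phi01)).
by rewrite natrM -mulrA ler_pM2l.
Qed.
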